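(* Let $r\in S_1=\left\{\frac{2\nu+1}{2j+1}:\nu,j\in\mathbb{Z}\right\}$. Then $R_{\beta}\in C^{\infty}_{w}(r)$ for any $\beta\in\mathbb{C}$. Moreover, the Dirichlet series $$\zeta_{r}(z)=\sum_{n=1}^{\infty}\frac{e^{i\pi rn^{2}}}{n^{z}}\quad(\mathrm{C}),\qquad z\in\mathbb{C},$$ defines an entire function in $z$, where the sums of the series for $\operatorname{Re}z<1$ are taken in the Cesàro sense, and the series is convergent on the closed half-plane $\operatorname{Re}z\geq 1$. In particular, for every $\beta\in\mathbb{C}$, the Łojasiewicz point values of the derivatives of $R_{\beta}$ at $r$ are given by $$R^{(m)}_{\beta}(r)= (i\pi)^{m} \zeta_{r}(2\beta-2m),\ \text{ distributionally, for all } m\in\mathbb{N}.$$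
   Context: $\mathbb{N}$ includes $0$. For $\beta\in\mathbb{C}$, $R_\beta(t)=\sum_{n=1}^\infty n^{-2\beta}e^{i\pi n^2t}\in\mathcal{S}'(\mathbb{R})$ (series convergent in $\mathcal{S}'(\mathbb{R})$). $S_1$ is the orbit $G_\vartheta\cdot1$ of $1$ under the theta group $G_\vartheta$, generated by the maps $z\mapsto z+2$ and $z\mapsto-1/z$. For $\alpha\in\mathbb{R}$ and $x_0\in\mathbb{R}$, $\mathcal{O}^\alpha(x_0)$ is the set of $f\in\mathcal{S}'(\mathbb{R})$ such that $\langle f(x_0+\varepsilon t),\varphi(t)\rangle=O(\varepsilon^\alpha)$ as $\varepsilon\to0^+$ for each $\varphi\in\mathcal{S}(\mathbb{R})$; $C^\alpha_w(x_0)$ is the set of $f\in\mathcal{S}'(\mathbb{R})$ for which there is a polynomial $P$ with $f-P\in\mathcal{O}^\alpha(x_0)$; and $C^\infty_w(x_0)=\bigcap_{\alpha\in\mathbb{R}}C^\alpha_w(x_0)$. A distribution $g$ has (Łojasiewicz) point value $v$ at $x_0$, written $g(x_0)=v$ distributionally, if $\lim_{\varepsilon\to0^+}\langle g(x_0+\varepsilon t),\varphi(t)\rangle=v\int\varphi(t)\,dt$ for each $\varphi\in\mathcal{D}(\mathbb{R})$. $\sum_{n\geq1}a_n=s$ $(\mathrm{C})$ means that the series is Cesàro summable $(\mathrm{C},k)$ to $s$ for some $k\in\mathbb{N}$, equivalently $\lim_{x\to\infty}\sum_{1\leq n<x}(1-n/x)^ka_n=s$ for some $k\in\mathbb{N}$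 ($k$ may depend on the series). *)

(* Defs.v *)
From Stdlib Require Import Reals ZArith.
From Coquelicot Require Import Coquelicot.

Open Scope R_scope.

Definition Cexp (z : C) : C :=
  (exp (Re z) * cos (Im z), exp (Re z) * sin (Im z)).

(* [x^z] for [0 < x], with the real logarithm. *)
Definition Cpower (x : R) (z : C) : C := Cexp (z * RtoC (ln x))%C.

Definition entire (f : C -> C) : Prop :=
  forall z : C, ex_derive (K := C_AbsRing) (V := C_NormedModule) f z.

Definition CDerive_n (phi : R -> C) (k : nat) (t : R) : C :=
  (Derive_n (fun s => Re (phi s)) k t, Derive_n (fun s => Im (phi s)) k t).

Definition smooth (phi : R -> C) : Prop :=
  forall (k : nat) (t : R),
    ex_derive_n (fun s => Re (phi s)) k t /\ ex_derive_n (fun s => Im (phi s)) k t.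

Definition schwartz (phi : R -> C) : Prop :=
  smooth phi /\
  forall j k : nat, exists B : R,
    forall t : R, Rabs t ^ j * Cmod (CDerive_n phi k t) <= B.

Definition test_function (phi : R -> C) : Prop :=
  smooth phi /\ exists A : R, forall t : R, A < Rabs t -> phi t = RtoC 0.

(* [sup_t |t|^j |phi^(k)(t)|], which is finite when [phi] is Schwartz. *)
Definition schwartz_seminorm (j k : nat) (phi : R -> C) : R :=
  real (Lub_Rbar (fun y => exists t : R, y = Rabs t ^ j * Cmod (CDerive_n phi k t))).

Definition integral (f : R -> C) : C :=
  RInt_gen (V := C_R_CompleteNormedModule) f
    (Rbar_locally m_infty) (Rbar_locally p_infty).

(* Functionals are total on [R -> C]; only their values on Schwartz functions
   are meaningful, and every notion below evaluates them there only. *)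
Definition functional := (R -> C) -> C.

Definition tempered (u : functional) : Prop :=
  (forall (phi psi : R -> C) (a b : C), schwartz phi -> schwartz psi ->
     u (fun t => a * phi t + b * psi t)%C = (a * u phi + b * u psi)%C) /\
  (exists (N : nat) (K : R), forall phi : R -> C, schwartz phi ->
     Cmod (u phi) <=
       K * sum_n (fun j => sum_n (fun k => schwartz_seminorm j k phi) N) N).

Definition regular (g : R -> C) : functional :=
  fun phi => integral (fun t => g t * phi t)%C.

Definition dist_minus (u v : functional) : functional :=
  fun phi => (u phi - v phi)%C.

Definition dist_derive_n (m : nat) (u : functional) : functional :=
  fun phi => (RtoC (-1) ^ m * u (CDerive_n phi m))%C.

(* The distribution [u (x0 + eps t)], for [0 < eps], by the change of variables
   [t -> (t - x0) / eps] in the pairing with [phi]. *)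
Definition dilate (u : functional) (x0 eps : R) : functional :=
  fun phi => u (fun t => RtoC (/ eps)%R * phi ((t - x0) / eps)%R)%C.

Definition polynomial (P : R -> C) : Prop :=
  exists (d : nat) (c : nat -> C),
    forall t : R, P t = sum_n (fun k => c k * RtoC (t ^ k)%R)%C d.

Definition O_space (alpha x0 : R) (u : functional) : Prop :=
  tempered u /\
  forall phi : R -> C, schwartz phi ->
    exists K : R,
      at_right 0 (fun eps => Cmod (dilate u x0 eps phi) <= K * Rpower eps alpha).

Definition Cw_space (alpha x0 : R) (u : functional) : Prop :=
  tempered u /\
  exists P : R -> C, polynomial P /\ O_space alpha x0 (dist_minus u (regular P)).

Definition Cw_infty (x0 : R) (u : functional) : Prop :=
  forall alpha : R, Cw_space alpha x0 u.

(* Lojasiewicz point value [u (x0) = v]. *)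
Definition point_value (u : functional) (x0 : R) (v : C) : Prop :=
  forall phi : R -> C, test_function phi ->
    filterlim (fun eps => dilate u x0 eps phi) (at_right 0)
      (locally (v * integral phi)%C).

Definition is_series1 (a : nat -> C) (s : C) : Prop :=
  is_series (K := C_AbsRing) (V := C_NormedModule) (fun n => a (S n)) s.

(* Convergence of [sum_(n >= 1) T n] to [u] in the weak topology of the space of
   tempered distributions. *)
Definition is_dist_series1 (T : nat -> functional) (u : functional) : Prop :=
  tempered u /\
  forall phi : R -> C, schwartz phi -> is_series1 (fun n => T n phi) (u phi).

(* Riesz form [sum_(1 <= n < x) (1 - n/x)^k a_n] of the [(C, k)] mean; every
   [n < x] is at most [up x]. *)
Definition cesaro_mean (k : nat) (a : nat -> C) (x : R) : C :=
  sum_n_m (fun n => if Rlt_dec (INR n) x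
                    then (RtoC ((1 - INR n / x) ^ k)%R * a n)%C else RtoC 0)
    1 (Z.to_nat (up x)).

Definition cesaro_sum (a : nat -> C) (s : C) : Prop :=
  exists k : nat,
    filterlim (cesaro_mean k a) (Rbar_locally p_infty) (locally s).

Definition R_term (beta : C) (n : nat) : functional :=
  fun phi =>
    (Cpower (INR n) (- (2 * beta)) *
     regular (fun t => Cexp (Ci * RtoC (PI * INR n ^ 2 * t)%R)) phi)%C.

(* Real and imaginary parts of the sum over [n >= 1] of [R_term beta n phi]. *)
Definition R_ (beta : C) : functional :=
  fun phi => (Series (fun n => Re (R_term beta (S n) phi)),
              Series (fun n => Im (R_term beta (S n) phi))).

Definition zeta_term (r : R) (z : C) (n : nat) : C :=
  (Cexp (Ci * RtoC (PI * r * INR n ^ 2)%R) / Cpower (INR n) z)%C.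

(* [None] is the point at infinity. *)
Definition Rhat := option R.

Definition translate (a : R) (w : Rhat) : Rhat := option_map (fun x => x + a) w.

Definition neg_inv (w : Rhat) : Rhat :=
  match w with
  | None => Some 0
  | Some x => if Req_EM_T x 0 then None else Some (- 1 / x)
  end.

(* [neg_inv] is an involution, so only the translation needs its inverse. *)
Inductive theta_group : (Rhat -> Rhat) -> Prop :=
| theta_id : theta_group (fun w => w)
| theta_translate g : theta_group g -> theta_group (fun w => translate 2 (g w))
| theta_untranslate g : theta_group g -> theta_group (fun w => translate (-2) (g w))
| theta_neg_inv g : theta_group g -> theta_group (fun w => neg_inv (g w)).

Definition S1 (w : Rhat) : Prop :=
  exists g : Rhat -> Rhat, theta_group g /\ w = g (Some 1).

(* Main.v *)
Require Import Defs.
From Stdlib Require Import Reals ZArith Lra Lia FunctionalExtensionality ClassicalEpsilon.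
From Coquelicot Require Import Coquelicot.

Open Scope R_scope.

(** Write [r = p / q] with [p], [q] odd. The coefficients [a_n = exp (i pi r n^2)] satisfy
    [a_(n+q) = - a_n], so that the Euler transform
    [sum a_n f(n) = 1/2 sum_(n <= q) a_n f(n) + sum a_n (f(n) - f(n+q)) / 2]
    gains one power of decay at each application to a symbol [f] (a function whose [k]-th
    derivative is [O(x^(s-k))]). Iterating it defines a regularised sum of [a_n f(n)] for every
    symbol [f], bounded by the symbol norm of [f]; on [f = x^(-z)] this is [zeta_r z]. Every
    assertion is then a bound on one symbol: [x^(-z-h) - x^(-z) + h ln x x^(-z)] is
    [O(|h|^2)], whence [zeta_r] is entire; [x^(-z) ((1 - x/X)_+^k - 1)] is [O(1/X)], whence the
    Cesaro sums; and, with [Phi] the Fourier transform of the test function and [T_m] its Taylor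
    polynomial at [0], [x^(-2 beta) (Phi - T_m) (eps x^2)] is [O(eps^m)], whence the expansion of
    [R_beta] at [r]. *)

(** * Series and the Euler transform *)

(** The series in question diverge for most exponents, so they cannot be handled through their
    partial sums. Regularised summation is therefore a relation [reg q N b s] of finite depth [N],
    shown to be linear, single-valued, stable under an increase of [N], and an extension of ordinary
    convergence. An identity between values then follows from the same identity between terms, and a
    convergent series, such as a Cesaro mean or a dilated pairing, can be compared with divergent
    ones. The estimate that carries the proof is [reg_symb]: its constant depends on the period, the
    depth and the degree only, hence is uniform in the symbol and in the parameters h, X and eps
    hidden in it. Symbols have finitely many controlled derivatives because the Riesz weight (1 -
    x/X)_+^k is not smooth at X; the Cesaro order is accordingly chosen in terms of Re z. The
    dilation by eps acts on x^2, and symbol estimates survive it because x d/dx commutes with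
    scaling and is only doubled by the square. *)

Definition csum (b : nat -> C) (s : C) : Prop :=
  is_series (K := C_AbsRing) (V := C_NormedModule) b s.

Lemma filterlim_C {T : Type} (F : (T -> Prop) -> Prop) {FF : Filter F} (f : T -> C) (l : C) :
  filterlim f F (locally l) <->
  forall eps : R, 0 < eps -> F (fun x => Cmod (f x - l)%C < eps).
Proof.
split.
- intros H eps He.
  exact (proj1 (filterlim_locally_ball_norm (K := C_AbsRing) (U := C_NormedModule) f l)
    H (mkposreal eps He)).
- intros H. apply (filterlim_locally_ball_norm (K := C_AbsRing) (U := C_NormedModule)).
  intros eps. exact (H eps (cond_pos eps)).
Qed.

Lemma csum_unique b s t : csum b s -> csum b t -> s = t.
Proof.
exact (filterlim_locally_unique (K := C_AbsRing) (V := C_NormedModule) (sum_n b) s t).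
Qed.

Lemma csum_plus b c s t : csum b s -> csum c t -> csum (fun n => b n + c n)%C (s + t)%C.
Proof. exact (is_series_plus (K := C_AbsRing) (V := C_NormedModule) b c s t). Qed.

Lemma csum_scal k b s : csum b s -> csum (fun n => k * b n)%C (k * s)%C.
Proof. exact (is_series_scal (K := C_AbsRing) (V := C_NormedModule) k b s). Qed.

Lemma csum_ext b c s : (forall n, b n = c n) -> csum b s -> csum c s.
Proof. exact (is_series_ext (K := C_AbsRing) (V := C_NormedModule) b c s). Qed.

(** Exactly [n] terms, none for n = 0, whereas [sum_n] at [n] has n + 1 terms. This makes splitting
    and shifting by a period free of off-by-one corrections. *)
Fixpoint psum (b : nat -> C) (n : nat) : C :=
  match n with O => 0%C | S m => (psum b m + b m)%C end.

Lemma sum_n_psum b n : sum_n (G := C_AbelianMonoid) b n = psum b (S n).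
Proof.
induction n as [|n IH].
- rewrite sum_O. symmetry. apply Cplus_0_l.
- rewrite sum_Sn, IH. reflexivity.
Qed.

Lemma psum_ext b c n : (forall k, (k < n)%nat -> b k = c k) -> psum b n = psum c n.
Proof.
induction n as [|n IH]; simpl; intros H; auto.
rewrite IH, H; auto.
Qed.

Lemma psum_plus b c n : psum (fun k => b k + c k)%C n = (psum b n + psum c n)%C.
Proof. induction n as [|n IH]; simpl; [|rewrite IH]; ring. Qed.

Lemma psum_scal k b n : psum (fun j => k * b j)%C n = (k * psum b n)%C.
Proof. induction n as [|n IH]; simpl; [|rewrite IH]; ring. Qed.

Lemma psum_add b m n : psum b (m + n) = (psum b m + psum (fun k => b (m + k)%nat) n)%C.
Proof.
induction n as [|n IH].
- rewrite Nat.add_0_r. simpl. ring.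
- rewrite Nat.add_succ_r. simpl. rewrite IH. ring.
Qed.

Lemma csum_psum b s : csum b s <-> filterlim (psum b) eventually (locally s).
Proof.
split; intros H.
- apply (filterlim_C eventually). intros eps He.
  destruct (proj1 (filterlim_C eventually _ _) H eps He) as [N HN].
  exists (S N). intros [|n] Hn; [lia|]. rewrite <- sum_n_psum. apply HN. lia.
- apply (filterlim_C eventually). intros eps He.
  destruct (proj1 (filterlim_C eventually _ _) H eps He) as [N HN].
  exists N. intros n Hn. rewrite sum_n_psum. apply HN. lia.
Qed.

Lemma csum_psum_eps b s : csum b s <->
  forall eps, 0 < eps -> exists N, forall n, (N <= n)%nat -> Cmod (psum b n - s)%C < eps.
Proof. rewrite csum_psum. apply (filterlim_C eventually). Qed.

Lemma csum_shift b s q :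
  csum b s -> csum (fun n => b (n + q)%nat) (s - psum b q)%C.
Proof.
rewrite !csum_psum_eps. intros H eps He.
destruct (H eps He) as [N HN]. exists N. intros n Hn.
specialize (HN (q + n)%nat ltac:(lia)). rewrite psum_add in HN.
replace (psum (fun k => b (k + q)%nat) n) with (psum (fun k => b (q + k)%nat) n).
- replace (psum (fun k => b (q + k)%nat) n - (s - psum b q))%C
    with (psum b q + psum (fun k => b (q + k)%nat) n - s)%C by ring. exact HN.
- apply psum_ext. intros k _. f_equal. lia.
Qed.

Lemma csum_finite (b : nat -> C) n : (forall k, (n <= k)%nat -> b k = 0%C) -> csum b (psum b n).
Proof.
intros H. apply csum_psum_eps. intros eps He. exists n. intros m Hm.
replace m with (n + (m - n))%nat by lia. rewrite psum_add.
assert (E : forall k, psum (fun k => b (n + k)%nat) k = 0%C).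
{ induction k as [|k IH]; simpl; auto. rewrite IH, H; [ring|lia]. }
rewrite E. replace (psum b n + 0 - psum b n)%C with (RtoC 0) by ring.
rewrite Cmod_0. exact He.
Qed.

Lemma psum_Cmod b beta n : (forall k, Cmod (b k) <= beta k) ->
  Cmod (psum b n) <= match n with O => 0 | S m => sum_n beta m end.
Proof.
intros H. induction n as [|n IH]; simpl.
- rewrite Cmod_0. lra.
- eapply Rle_trans; [apply Cmod_triangle|]. destruct n as [|n].
  + rewrite sum_O. change (psum b 0) with (RtoC 0). rewrite Cmod_0, Rplus_0_l. apply H.
  + rewrite sum_Sn. apply Rplus_le_compat; [exact IH|apply H].
Qed.

Lemma csum_dominated b beta l : (forall k, Cmod (b k) <= beta k) -> is_series beta l ->
  exists s, csum b s /\ Cmod s <= l.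
Proof.
intros Hb Hl.
assert (Hex : exists s : C, csum b s).
{ apply (ex_series_le (K := C_AbsRing) (V := C_CompleteNormedModule) b beta Hb).
  exists l. exact Hl. }
destruct Hex as [s Hs]. exists s. split; [exact Hs|].
apply Rnot_lt_le. intros Hlt.
destruct (proj1 (csum_psum_eps b s) Hs (Cmod s - l) ltac:(lra)) as [N HN].
specialize (HN (S N) ltac:(lia)).
assert (Hp := psum_Cmod b beta (S N) Hb). simpl in Hp.
assert (Hle : sum_n beta N <= l).
{ apply (is_lim_seq_incr_compare (sum_n beta)).
  - exact Hl.
  - intros n. rewrite sum_Sn. unfold plus; simpl.
    assert (h := Hb (S n)). assert (h' := Cmod_ge_0 (b (S n))). lra. }
assert (Ht := Cmod_triangle (psum b (S N)) (s - psum b (S N))%C).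
replace (psum b (S N) + (s - psum b (S N)))%C with s in Ht by ring.
replace (s - psum b (S N))%C with (- (psum b (S N) - s))%C in Ht by ring.
rewrite Cmod_opp in Ht. simpl in *. lra.
Qed.

(** * The iterated Euler transform as a summation method *)

Definition avg (q : nat) (b : nat -> C) (n : nat) : C :=
  (RtoC (1 / 2) * (b n + b (n + q)%nat))%C.

(** Each step takes half of the first [q] terms out of the value and passes to the averaged
    sequence; after [N] steps the series must converge. A relation, since existence depends on the
    depth while the value does not. *)
Fixpoint reg (q N : nat) (b : nat -> C) (s : C) : Prop :=
  match N with
  | O => csum b s
  | S M => reg q M (avg q b) (s - RtoC (1 / 2) * psum b q)%C
  end.

Lemma reg_ext q N : forall b c s, (forall n, b n = c n) -> reg q N b s -> reg q N c s.
Proof.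
intros b c s H. replace c with b; auto. apply functional_extensionality, H.
Qed.

Lemma reg_unique q N : forall b s t, reg q N b s -> reg q N b t -> s = t.
Proof.
induction N as [|N IH]; simpl; intros b s t Hs Ht.
- eapply csum_unique; eauto.
- assert (E := IH _ _ _ Hs Ht).
  replace s with (s - RtoC (1 / 2) * psum b q + RtoC (1 / 2) * psum b q)%C by ring.
  rewrite E. ring.
Qed.

Lemma reg_plus q N : forall b c s t, reg q N b s -> reg q N c t ->
  reg q N (fun n => b n + c n)%C (s + t)%C.
Proof.
induction N as [|N IH]; simpl; intros b c s t Hs Ht.
- apply csum_plus; auto.
- rewrite psum_plus.
  replace (s + t - RtoC (1 / 2) * (psum b q + psum c q))%C with
    ((s - RtoC (1 / 2) * psum b q) + (t - RtoC (1 / 2) * psum c q))%C by ring.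
  eapply reg_ext; [|apply IH; eassumption].
  intros n. unfold avg. ring.
Qed.

Lemma reg_scal q N : forall k b s, reg q N b s -> reg q N (fun n => k * b n)%C (k * s)%C.
Proof.
induction N as [|N IH]; simpl; intros k b s Hs.
- apply csum_scal; auto.
- rewrite psum_scal.
  replace (k * s - RtoC (1 / 2) * (k * psum b q))%C with
    (k * (s - RtoC (1 / 2) * psum b q))%C by ring.
  eapply reg_ext; [|apply IH; eassumption].
  intros n. unfold avg. ring.
Qed.

(** The shifted series sums to s minus its first [q] terms, so the mean of the two sums is s minus
    half of those terms: the transform is consistent with convergence. *)
Lemma csum_avg q b s : csum b s -> csum (avg q b) (s - RtoC (1 / 2) * psum b q)%C.
Proof.
intros H.
replace (s - RtoC (1 / 2) * psum b q)%C
  with (RtoC (1 / 2) * (s + (s - psum b q)))%C.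
- apply csum_scal, csum_plus; auto. apply csum_shift, H.
- replace s with (RtoC (1 / 2) * (s + s))%C at 3.
  + ring.
  + apply injective_projections; simpl; field.
Qed.

Lemma reg_succ q N : forall b s, reg q N b s -> reg q (S N) b s.
Proof.
induction N as [|N IH]; intros b s H.
- apply csum_avg, H.
- simpl. apply IH. exact H.
Qed.

Lemma reg_le q N N' b s : (N <= N')%nat -> reg q N b s -> reg q N' b s.
Proof. induction 1; auto. intros H'. apply reg_succ; auto. Qed.

(** A Tauberian converse for one step. Apart from the first block, already accounted for in [reg],
    the partial sums of [b] and of [avg q b] differ by half of the [q] terms that follow index n,
    and these vanish in the limit. *)
Lemma csum_of_reg1 q b s :
  (forall eps, 0 < eps -> exists N, forall n, (N <= n)%nat -> Cmod (b n) < eps) ->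
  reg q 1 b s -> csum b s.
Proof.
intros Hb H. simpl in H. rewrite csum_psum_eps in *.
assert (Htail : forall k eps, 0 < eps -> exists N, forall n, (N <= n)%nat ->
  Cmod (psum (fun j => b (n + j)%nat) k) < eps).
{ induction k as [|k IH]; intros eps He; simpl.
  - exists 0%nat. intros. rewrite Cmod_0. exact He.
  - destruct (IH (eps / 2) ltac:(lra)) as [N1 H1].
    destruct (Hb (eps / 2) ltac:(lra)) as [N2 H2].
    exists (N1 + N2)%nat. intros n Hn.
    eapply Rle_lt_trans; [apply Cmod_triangle|].
    specialize (H1 n ltac:(lia)). specialize (H2 (n + k)%nat ltac:(lia)). lra. }
intros eps He.
destruct (H (eps / 2) ltac:(lra)) as [N1 H1].
destruct (Htail q (eps / 2) ltac:(lra)) as [N2 H2].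
exists (N1 + N2)%nat. intros n Hn.
specialize (H1 n ltac:(lia)). specialize (H2 n ltac:(lia)).
assert (E : (psum b n - s = (psum (avg q b) n - (s - RtoC (1 / 2) * psum b q))
   + - (RtoC (1 / 2) * psum (fun j => b (n + j)%nat) q))%C).
{ unfold avg. rewrite psum_scal, psum_plus.
  replace (psum (fun k => b (k + q)%nat) n) with (psum (fun k => b (q + k)%nat) n)
    by (apply psum_ext; intros; f_equal; lia).
  assert (E1 := psum_add b q n). assert (E2 := psum_add b n q).
  rewrite Nat.add_comm, E1 in E2.
  replace (psum (fun k => b (q + k)%nat) n) with
    (psum b n + psum (fun k => b (n + k)%nat) q - psum b q)%C
    by (rewrite <- E2; ring).
  apply injective_projections; simpl; field. }
rewrite E. eapply Rle_lt_trans; [apply Cmod_triangle|].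
rewrite Cmod_opp, Cmod_mult, Cmod_R, Rabs_pos_eq by lra.
assert (h := Cmod_ge_0 (psum (fun j => b (n + j)%nat) q)). simpl in *. lra.
Qed.

(** * Symbols *)

(** Componentwise, in agreement with [CDerive_n], so that real calculus applies to each part. *)
Definition derC (f : R -> C) (x : R) (l : C) : Prop :=
  is_derive (fun y => Re (f y)) x (Re l) /\ is_derive (fun y => Im (f y)) x (Im l).

Lemma is_derive_eq (f : R -> R) (x l l' : R) : l = l' -> is_derive f x l -> is_derive f x l'.
Proof. intros ->. auto. Qed.

Lemma derC_eq f x l l' : l = l' -> derC f x l -> derC f x l'.
Proof. intros ->. auto. Qed.

Lemma derC_const c x : derC (fun _ => c) x 0%C.
Proof. split; apply (is_derive_const (K := R_AbsRing) (V := R_NormedModule)). Qed.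

Lemma derC_plus f g x l m : derC f x l -> derC g x m ->
  derC (fun y => f y + g y)%C x (l + m)%C.
Proof. intros [H1 H2] [H3 H4]. split; simpl; apply @is_derive_plus; assumption. Qed.

Lemma derC_mult f g x l m : derC f x l -> derC g x m ->
  derC (fun y => f y * g y)%C x (l * g x + f x * m)%C.
Proof.
assert (P : forall (u v : R -> R) a b, is_derive u x a -> is_derive v x b ->
  is_derive (fun y => u y * v y) x (a * v x + u x * b)).
{ intros u v a b Hu Hv.
  apply (is_derive_mult (K := R_AbsRing) u v x a b Hu Hv). intros; apply Rmult_comm. }
intros [H1 H2] [H3 H4]. split; simpl.
- eapply is_derive_eq; [|apply @is_derive_minus; apply P; eassumption].
  unfold minus, plus, opp; simpl. unfold Re, Im. ring.
- eapply is_derive_eq; [|apply @is_derive_plus; apply P; eassumption].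
  unfold minus, plus, opp; simpl. unfold Re, Im. ring.
Qed.

Lemma derC_scal c f x l : derC f x l -> derC (fun y => c * f y)%C x (c * l)%C.
Proof.
intros H. eapply derC_eq; [|apply (derC_mult (fun _ => c) f); [apply derC_const|exact H]].
ring.
Qed.

Lemma derC_minus f g x l m : derC f x l -> derC g x m ->
  derC (fun y => f y - g y)%C x (l - m)%C.
Proof. intros [H1 H2] [H3 H4]. split; simpl; apply @is_derive_minus; assumption. Qed.

Lemma derC_RtoC g x l : is_derive g x l -> derC (fun y => RtoC (g y)) x (RtoC l).
Proof.
intros H. split; simpl; [exact H|]. apply (is_derive_const (K := R_AbsRing) (V := R_NormedModule)).
Qed.

Lemma derC_comp f g x l m : derC f (g x) l -> is_derive g x m ->
  derC (fun y => f (g y)) x (RtoC m * l)%C.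
Proof.
intros [H1 H2] H. split; simpl.
- eapply is_derive_eq; [|apply (is_derive_comp (fun y => Re (f y)) g); eassumption].
  unfold scal, Re, Im; simpl; unfold mult; simpl. ring.
- eapply is_derive_eq; [|apply (is_derive_comp (fun y => Im (f y)) g); eassumption].
  unfold scal, Re, Im; simpl; unfold mult; simpl. ring.
Qed.

Lemma derC_ext_loc f g x l : locally x (fun y => f y = g y) -> derC f x l -> derC g x l.
Proof.
intros H [H1 H2]. split; eapply is_derive_ext_loc; try eassumption;
  revert H; apply filter_imp; intros y ->; reflexivity.
Qed.

Lemma Cmod_le_Re_Im z : Cmod z <= Rabs (Re z) + Rabs (Im z).
Proof.
replace z with (RtoC (Re z) + Ci * RtoC (Im z))%C at 1.
- eapply Rle_trans; [apply Cmod_triangle|].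
  rewrite Cmod_mult, Cmod_Ci, !Cmod_R. lra.
- apply injective_projections; simpl; unfold Re, Im; ring.
Qed.

Lemma im_le_Cmod z : Rabs (Im z) <= Cmod z.
Proof. eapply Rle_trans; [|apply Rmax_Cmod]. apply Rmax_r. Qed.

(** The factor 2 comes from applying the real mean value theorem to the two components
    separately. *)
Lemma mean_value_ineq (f f' : R -> C) x y M : x <= y ->
  (forall t, x <= t <= y -> derC f t (f' t)) ->
  (forall t, x <= t <= y -> Cmod (f' t) <= M) ->
  Cmod (f y - f x)%C <= 2 * M * (y - x).
Proof.
intros Hxy Hd HM.
assert (P : forall (u u' : R -> R), (forall t, x <= t <= y -> is_derive u t (u' t)) ->
  (forall t, x <= t <= y -> Rabs (u' t) <= M) -> Rabs (u y - u x) <= M * (y - x)).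
{ intros u u' Hu Hu'.
  destruct (MVT_gen u x y u') as [c [Hc E]]; rewrite ?Rmin_left, ?Rmax_right in * by lra.
  - intros t Ht. apply Hu. lra.
  - intros t Ht. apply derivable_continuous_pt. exists (u' t).
    apply is_derive_Reals, Hu, Ht.
  - rewrite E, Rabs_mult, (Rabs_pos_eq (y - x)) by lra.
    apply Rmult_le_compat_r; [lra|]. apply Hu', Hc. }
eapply Rle_trans; [apply Cmod_le_Re_Im|].
assert (P1 := P (fun t => Re (f t)) (fun t => Re (f' t))
  (fun t Ht => proj1 (Hd t Ht))
  (fun t Ht => Rle_trans _ _ _ (re_le_Cmod _) (HM t Ht))).
assert (P2 := P (fun t => Im (f t)) (fun t => Im (f' t))
  (fun t Ht => proj2 (Hd t Ht))
  (fun t Ht => Rle_trans _ _ _ (im_le_Cmod _) (HM t Ht))).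
unfold Re, Im in *; simpl. unfold Rminus in *. lra.
Qed.

Lemma Rpower_pos x s : 0 < Rpower x s.
Proof. apply exp_pos. Qed.

(** The ratio y / x lies in [1, 1 + h]; the absolute value of [s] covers both signs of the
    exponent. *)
Lemma Rpower_shift_le s h x y : 1 <= x -> 0 <= h -> x <= y <= x + h ->
  Rpower y s <= Rpower (1 + h) (Rabs s) * Rpower x s.
Proof.
intros Hx Hh Hy.
replace y with (x * (y / x)) by (field; lra).
assert (H1 : 1 <= y / x) by (apply Rmult_le_reg_r with x; [lra|]; field_simplify; lra).
rewrite <- Rpower_mult_distr by lra. rewrite Rmult_comm.
apply Rmult_le_compat_r; [apply Rlt_le, Rpower_pos|].
apply Rle_trans with (Rpower (y / x) (Rabs s)).
- apply Rle_Rpower; [lra|apply Rle_abs].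
- apply Rle_Rpower_l; [apply Rabs_pos|]. split; [lra|].
  apply Rmult_le_reg_r with x; [lra|]. unfold Rdiv. rewrite Rmult_assoc, Rinv_l by lra.
  nra.
Qed.

(** One constant [B] bounds all [N] derivatives in their respective degrees, and so plays the role
    of a symbol norm. Only x >= 1 matters, since symbols are sampled at positive integers. *)
Fixpoint symb (N : nat) (s B : R) (f : R -> C) : Prop :=
  (forall x, 1 <= x -> Cmod (f x) <= B * Rpower x s) /\
  match N with
  | O => True
  | S M => exists f', (forall x, 1 <= x -> derC f x (f' x)) /\ symb M (s - 1) B f'
  end.

Lemma symb_bound N s B f x : symb N s B f -> 1 <= x -> Cmod (f x) <= B * Rpower x s.
Proof. destruct N; intros [H _]; apply H. Qed.

Lemma symb_ext N s B f g : (forall x, f x = g x) -> symb N s B f -> symb N s B g.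
Proof. intros H. replace g with f; auto. apply functional_extensionality, H. Qed.

Lemma symb_pos N s B f : symb N s B f -> 0 <= B.
Proof.
intros H. assert (H1 := symb_bound _ _ _ _ 1 H (Rle_refl 1)).
assert (H2 := Cmod_ge_0 (f 1)). unfold Rpower in H1.
rewrite ln_1, Rmult_0_r, exp_0 in H1. lra.
Qed.

Lemma symb_le N : forall s B t B' f, s <= t -> B <= B' -> symb N s B f -> symb N t B' f.
Proof.
induction N as [|N IH]; intros s B t B' f Hs HB H; assert (HB0 := symb_pos _ _ _ _ H);
 destruct H as [H H']; (split;
  [intros x Hx; eapply Rle_trans; [apply H, Hx|];
   apply Rmult_le_compat; auto; [apply Rlt_le, Rpower_pos|apply Rle_Rpower; lra]|]); auto.
destruct H' as [f' [H1 H2]]. exists f'. split; auto.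
apply (IH (s - 1) B); auto; lra.
Qed.

Lemma symb_pred N s B f : symb (S N) s B f -> symb N s B f.
Proof.
revert s B f. induction N as [|N IH]; intros s B f [H [f' [H1 H2]]]; split; auto.
exists f'. split; auto.
Qed.

Lemma symb_plus N : forall s B B' f g, symb N s B f -> symb N s B' g ->
  symb N s (B + B') (fun x => f x + g x)%C.
Proof.
induction N as [|N IH]; intros s B B' f g [Hf Hf'] [Hg Hg']; (split;
  [intros x Hx; eapply Rle_trans; [apply Cmod_triangle|]; rewrite Rmult_plus_distr_r;
   apply Rplus_le_compat; auto|]); auto.
destruct Hf' as [f' [F1 F2]], Hg' as [g' [G1 G2]].
exists (fun x => f' x + g' x)%C. split; [|apply IH; auto].
intros x Hx. apply derC_plus; auto.
Qed.

Lemma symb_scal N : forall s B c f, symb N s B f -> symb N s (Cmod c * B) (fun x => c * f x)%C.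
Proof.
induction N as [|N IH]; intros s B c f [Hf Hf']; (split;
  [intros x Hx; rewrite Cmod_mult, Rmult_assoc; apply Rmult_le_compat_l; auto;
   apply Cmod_ge_0|]); auto.
destruct Hf' as [f' [F1 F2]].
exists (fun x => c * f' x)%C. split; [|apply IH; auto].
intros x Hx. apply derC_scal; auto.
Qed.

(** The Leibniz rule produces two products per derivative, whence 2^N. *)
Lemma symb_mult N : forall s t B B' f g, symb N s B f -> symb N t B' g ->
  symb N (s + t) (2 ^ N * (B * B')) (fun x => f x * g x)%C.
Proof.
assert (P : forall N s t B B' f g, symb N s B f -> symb N t B' g ->
  forall x, 1 <= x -> Cmod (f x * g x)%C <= 2 ^ N * (B * B') * Rpower x (s + t)).
{ intros M s t B B' f g Hf Hg x Hx.
  assert (HB := symb_pos _ _ _ _ Hf). assert (HB' := symb_pos _ _ _ _ Hg).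
  rewrite Cmod_mult, Rpower_plus.
  apply Rle_trans with (1 * ((B * Rpower x s) * (B' * Rpower x t))).
  - rewrite Rmult_1_l. apply Rmult_le_compat; try apply Cmod_ge_0; eapply symb_bound; eauto.
  - replace (2 ^ M * (B * B') * (Rpower x s * Rpower x t)) with
     (2 ^ M * ((B * Rpower x s) * (B' * Rpower x t))) by ring.
    apply Rmult_le_compat_r; [|apply pow_R1_Rle; lra].
    assert (h1 := Rpower_pos x s). assert (h2 := Rpower_pos x t).
    repeat apply Rmult_le_pos; lra. }
induction N as [|N IH]; intros s t B B' f g Hf Hg.
- split; [intros x Hx; apply (P 0%nat); auto|exact I].
- split; [intros x Hx; apply (P (S N)); auto|].
  assert (Hf0 := symb_pred _ _ _ _ Hf). assert (Hg0 := symb_pred _ _ _ _ Hg).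
  destruct Hf as [_ [f' [F1 F2]]], Hg as [_ [g' [G1 G2]]].
  exists (fun x => f' x * g x + f x * g' x)%C. split.
  + intros x Hx. apply derC_mult; auto.
  + replace (2 ^ S N * (B * B')) with (2 ^ N * (B * B') + 2 ^ N * (B * B'))
      by (simpl; ring).
    apply symb_plus.
    * replace (s + t - 1) with ((s - 1) + t) by ring. apply IH; auto.
    * replace (s + t - 1) with (s + (t - 1)) by ring. apply IH; auto.
Qed.

(** For s >= 0 the derivative on [1, x] is at most B x^s, and the interval is shorter than x. For s
    = 0 this yields degree 1 where a logarithm would do; the loss is harmless because regularised
    sums exist in every degree. *)
Lemma symb_primitive N s B (f f' : R -> C) : 0 <= s -> f 1 = 0%C ->
  (forall x, 1 <= x -> derC f x (f' x)) -> symb N s B f' ->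
  symb (S N) (s + 1) (2 * B) f.
Proof.
intros Hs H1 Hd H. assert (HB := symb_pos _ _ _ _ H). split.
- intros x Hx. assert (E : f x = (f x - f 1)%C) by (rewrite H1; ring). rewrite E. clear E.
  eapply Rle_trans.
  + apply (mean_value_ineq f f' 1 x (B * Rpower x s)); auto.
    * intros t Ht. apply Hd. lra.
    * intros t Ht. eapply Rle_trans; [eapply symb_bound; [exact H|lra]|].
      apply Rmult_le_compat_l; auto. apply Rle_Rpower_l; lra.
  + rewrite Rpower_plus, Rpower_1 by lra.
    assert (h := Rpower_pos x s).
    assert (0 <= B * Rpower x s) by (apply Rmult_le_pos; lra). nra.
- exists f'. split; auto. apply symb_le with s B; auto; lra.
Qed.

Definition delta (h : R) (f : R -> C) (x : R) : C :=
  (RtoC (1 / 2) * (f x - f (x + h)%R))%C.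

(** A difference over a fixed step behaves like a derivative: by the mean value inequality it gains
    one degree at the price of one derivative. The constant does not depend on the symbol. *)
Lemma symb_delta (h : R) (Hh : 0 <= h) N : forall s, exists K, 0 <= K /\
  forall B f, symb (S N) s B f -> symb N (s - 1) (K * B) (delta h f).
Proof.
assert (P : forall s, exists K, 0 <= K /\ forall N B f, symb (S N) s B f ->
  forall x, 1 <= x -> Cmod (delta h f x) <= K * B * Rpower x (s - 1)).
{ intros s. exists (h * Rpower (1 + h) (Rabs (s - 1))). split.
  - apply Rmult_le_pos; auto. apply Rlt_le, Rpower_pos.
  - intros M B f H x Hx. assert (HB := symb_pos _ _ _ _ H).
    destruct H as [_ [f' [H1 H2]]].
    unfold delta. rewrite Cmod_mult, Cmod_R, Rabs_pos_eq by lra.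
    rewrite <- Cmod_opp. replace (- (f x - f (x + h)%R))%C with (f (x + h)%R - f x)%C by ring.
    assert (h0 := mean_value_ineq f f' x (x + h)
      (B * (Rpower (1 + h) (Rabs (s - 1)) * Rpower x (s - 1)))).
    assert (h1 : Cmod (f (x + h)%R - f x)%C <= 2 * (B * (Rpower (1 + h) (Rabs (s - 1)) *
      Rpower x (s - 1))) * (x + h - x)).
    { apply h0; [lra| |].
      - intros t Ht. apply H1. lra.
      - intros t Ht. eapply Rle_trans; [eapply symb_bound; [exact H2|lra]|].
        apply Rmult_le_compat_l; auto. apply Rpower_shift_le; auto. }
    replace (x + h - x) with h in h1 by ring.
    eapply Rle_trans; [apply Rmult_le_compat_l; [lra|exact h1]|]. right. field. }
induction N as [|N IH]; intros s; destruct (P s) as [K [HK HP]].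
- exists K. split; [exact HK|]. intros B f H. split; [exact (HP 0%nat B f H)|exact I].
- destruct (IH (s - 1)) as [K' [HK' HI]]. exists (K + K'). split; [lra|].
  intros B f H. assert (HB := symb_pos _ _ _ _ H). split.
  + intros x Hx. eapply Rle_trans; [apply (HP (S N) B f H x Hx)|].
    apply Rmult_le_compat_r; [apply Rlt_le, Rpower_pos|]. nra.
  + destruct H as [_ [f' [H1 H2]]]. exists (delta h f'). split.
    * intros x Hx. unfold delta. apply derC_scal.
      apply derC_minus; [apply H1, Hx|].
      eapply derC_eq;
         [|apply (derC_comp f (fun y => y + h) x (f' (x + h)) 1); [apply H1; lra|]].
      -- ring.
      -- auto_derive; auto.
    * apply symb_le with (s - 1 - 1) (K' * B); [lra|nra|]. apply HI, H2.
Qed.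

(** * Regularised sums of symbols and complex powers *)

(** Series over n >= 1 are reindexed from 0: [a n] is the coefficient attached to the integer n +
    1. *)
Definition smp (a : nat -> C) (f : R -> C) (n : nat) : C := (a n * f (INR (S n)))%C.

Definition antiperiodic (q : nat) (a : nat -> C) : Prop :=
  (forall n, a (n + q)%nat = - a n)%C /\ forall n, Cmod (a n) <= 1.

Lemma INR_S_ge_1 n : 1 <= INR (S n).
Proof. rewrite S_INR. assert (h := pos_INR n). lra. Qed.

(** The change of sign over a period turns the average of terms into a difference of symbol values;
    this is the source of all cancellation. *)
Lemma avg_smp q a f : antiperiodic q a ->
  avg q (smp a f) = smp a (delta (INR q) f).
Proof.
intros [Ha _]. apply functional_extensionality. intros n.
unfold avg, smp, delta. rewrite Ha.
replace (INR (S (n + q))) with (INR (S n) + INR q)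
  by (rewrite <- plus_INR; f_equal; lia).
ring.
Qed.

(** For x >= 1 one has 1/x^2 <= 2/(x(x+1)), a telescoping majorant with an explicit sum. *)
Lemma inv_square_le n : / INR (S n) ^ 2 <= 2 * (/ INR (S n) - / INR (S (S n))).
Proof.
assert (h := INR_S_ge_1 n). rewrite (S_INR (S n)).
set (x := INR (S n)) in *.
apply Rmult_le_reg_r with (x ^ 2 * (x + 1)); [nra|]. field_simplify; [|lra|lra]. lra.
Qed.

Lemma is_series_telescope : is_series (fun n => / INR (S n) - / INR (S (S n))) 1.
Proof.
assert (E : forall n, sum_n (fun n => / INR (S n) - / INR (S (S n))) n
  = 1 - / INR (S (S n))).
{ induction n as [|n IH].
  - rewrite sum_O. simpl. lra.
  - rewrite sum_Sn, IH. unfold plus; simpl. lra. }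
change (is_lim_seq (sum_n (fun n => / INR (S n) - / INR (S (S n)))) 1).
apply (is_lim_seq_ext (fun n => 1 - / INR (S (S n)))); [intros n; symmetry; apply E|].
replace (Finite 1) with (Rbar_minus 1 0) by (simpl; f_equal; ring).
apply is_lim_seq_minus'; [apply is_lim_seq_const|].
apply is_lim_seq_incr_1 with (u := fun n => / INR (S n)).
apply is_lim_seq_incr_1 with (u := fun n => / INR n).
apply (is_lim_seq_inv _ p_infty); [apply is_lim_seq_INR|discriminate].
Qed.

Lemma Rpower_neg2 x : 0 < x -> Rpower x (-2) = / x ^ 2.
Proof.
intros Hx. replace (-2) with (- INR 2) by (simpl; ring).
rewrite Rpower_Ropp, Rpower_pow; auto.
Qed.

Lemma psum_smp_le q s : exists K, 0 <= K /\ forall a B (f : R -> C),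
  (forall n, Cmod (a n) <= 1) -> (forall x, 1 <= x -> Cmod (f x) <= B * Rpower x s) ->
  Cmod (psum (smp a f) q) <= K * B.
Proof.
induction q as [|q [K [HK IH]]].
- exists 0. split; [lra|]. intros. simpl. rewrite Cmod_0. lra.
- assert (hp := Rpower_pos (INR (S q)) s).
  exists (K + Rpower (INR (S q)) s). split; [lra|]. intros a B f Ha Hf.
  change (psum (smp a f) (S q)) with (psum (smp a f) q + a q * f (INR (S q)))%C.
  eapply Rle_trans; [apply Cmod_triangle|]. rewrite Rmult_plus_distr_r.
  apply Rplus_le_compat; [apply IH; auto|]. rewrite Cmod_mult.
  assert (h2 := Hf _ (INR_S_ge_1 q)). assert (h3 := Ha q).
  assert (h4 := Cmod_ge_0 (f (INR (S q)))). nra.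
Qed.

(** Each Euler step lowers the degree by one until it is at most -2, where the series is absolutely
    convergent. [K] is chosen before [a], [B] and [f], so a small symbol norm forces a small
    regularised sum. *)
Lemma reg_symb q N : forall s, s - INR N <= -2 -> exists K, 0 <= K /\
  forall a B f, antiperiodic q a -> symb N s B f ->
    exists t, reg q N (smp a f) t /\ Cmod t <= K * B.
Proof.
induction N as [|N IH]; intros s Hs.
- exists 2. split; [lra|]. intros a B f [_ Ha] Hf. simpl in Hs.
  assert (HB := symb_pos _ _ _ _ Hf).
  apply (csum_dominated _ (fun n => 2 * B * (/ INR (S n) - / INR (S (S n))))).
  + intros n. unfold smp. rewrite Cmod_mult.
    assert (h1 := INR_S_ge_1 n). assert (h2 := symb_bound _ _ _ _ _ Hf h1).
    apply Rle_trans with (1 * (B * / INR (S n) ^ 2)).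
    * apply Rmult_le_compat; try apply Cmod_ge_0; auto.
      eapply Rle_trans; [exact h2|]. apply Rmult_le_compat_l; auto.
      rewrite <- Rpower_neg2 by lra. apply Rle_Rpower; lra.
    * rewrite Rmult_1_l. assert (h3 := inv_square_le n).
      replace (2 * B * (/ INR (S n) - / INR (S (S n)))) with
        (B * (2 * (/ INR (S n) - / INR (S (S n))))) by ring.
      apply Rmult_le_compat_l; auto.
  + assert (h := is_series_scal (K := R_AbsRing) (V := R_NormedModule) (2 * B) _ _
      is_series_telescope).
    change (is_series (fun n => 2 * B * (/ INR (S n) - / INR (S (S n)))) (2 * B * 1)) in h.
    rewrite Rmult_1_r in h. exact h.
- destruct (symb_delta (INR q) (pos_INR q) N s) as [K1 [HK1 H1]].
  destruct (IH (s - 1)) as [K2 [HK2 H2]]; [rewrite S_INR in Hs; lra|].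
  destruct (psum_smp_le q s) as [K3 [HK3 H3]].
  exists (K2 * K1 + K3). split; [nra|].
  intros a B f Ha Hf. assert (HB := symb_pos _ _ _ _ Hf).
  destruct (H2 a (K1 * B) (delta (INR q) f) Ha (H1 B f Hf)) as [t [Ht1 Ht2]].
  exists (t + RtoC (1 / 2) * psum (smp a f) q)%C. split.
  + simpl. rewrite avg_smp by exact Ha.
    replace (t + RtoC (1 / 2) * psum (smp a f) q - RtoC (1 / 2) * psum (smp a f) q)%C
      with t by ring. exact Ht1.
  + eapply Rle_trans; [apply Cmod_triangle|].
    rewrite Cmod_mult, Cmod_R, Rabs_pos_eq by lra.
    assert (h := H3 a B f (proj2 Ha) (fun x => symb_bound _ _ _ _ x Hf)).
    assert (h' := Cmod_ge_0 (psum (smp a f) q)). nra.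
Qed.

(** * Complex powers and logarithms as symbols *)

Lemma Cmod_Cexp z : Cmod (Cexp z) = exp (Re z).
Proof.
unfold Cexp, Cmod; simpl.
replace (_ * _ * (_ * _ * 1) + _) with (exp (Re z) * exp (Re z)).
- apply sqrt_square, Rlt_le, exp_pos.
- assert (h := sin2_cos2 (Im z)). unfold Rsqr in h.
  transitivity (exp (Re z) * exp (Re z) * (sin (Im z) * sin (Im z) + cos (Im z) * cos (Im z))).
  + rewrite h. ring.
  + ring.
Qed.

Lemma Cexp_plus z w : Cexp (z + w)%C = (Cexp z * Cexp w)%C.
Proof.
unfold Cexp. apply injective_projections; simpl; unfold Re, Im;
  rewrite exp_plus, ?cos_plus, ?sin_plus; ring.
Qed.

Lemma Cmod_Cpower x w : Cmod (Cpower x w) = Rpower x (Re w).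
Proof.
unfold Cpower. rewrite Cmod_Cexp. unfold Rpower. f_equal. simpl. unfold Re. ring.
Qed.

Lemma Cpower_plus x w v : Cpower x (w + v)%C = (Cpower x w * Cpower x v)%C.
Proof. unfold Cpower. rewrite <- Cexp_plus. f_equal. ring. Qed.

Lemma Cpower_0 x : Cpower x 0 = 1%C.
Proof.
unfold Cpower. rewrite Cmult_0_l. unfold Cexp. simpl.
rewrite exp_0, cos_0, sin_0. apply injective_projections; simpl; ring.
Qed.

Lemma Cpower_RtoC x s : Cpower x (RtoC s) = RtoC (Rpower x s).
Proof.
unfold Cpower, Cexp, Rpower. apply injective_projections; simpl; unfold Re, Im; simpl;
replace (s * 0 + 0 * ln x) with 0 by ring; rewrite ?cos_0, ?sin_0;
replace (s * ln x - 0 * 0) with (s * ln x) by ring; ring.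
Qed.

Lemma Cpower_m1 x : 0 < x -> Cpower x (- (1)) = RtoC (/ x).
Proof.
intros Hx. replace (- (1))%C with (RtoC (- (1))) by (apply injective_projections; simpl; ring).
rewrite Cpower_RtoC, Rpower_Ropp, Rpower_1; auto.
Qed.

Lemma Cpower_1_l w : Cpower 1 w = 1%C.
Proof.
unfold Cpower. rewrite ln_1, Cmult_0_r. unfold Cexp. simpl.
rewrite exp_0, cos_0, sin_0. apply injective_projections; simpl; ring.
Qed.

Lemma derC_Cpower w x : 0 < x ->
  derC (fun y => Cpower y w) x (w * Cpower x (w - 1))%C.
Proof.
intros Hx. unfold Cminus. rewrite Cpower_plus, Cpower_m1 by exact Hx.
split; simpl; unfold Re, Im; simpl; auto_derive; auto; unfold Rminus; ring.
Qed.

Lemma derC_ln x : 0 < x -> derC (fun y => RtoC (ln y)) x (Cpower x (- (1))).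
Proof.
intros Hx. rewrite Cpower_m1 by exact Hx. apply derC_RtoC. auto_derive; auto. field. lra.
Qed.

(** Uniform over a disc of exponents, because differentiability in z perturbs the exponent. The
    derivative w x^(w-1) leaves the disc of radius [A], so the induction uses the radius A + 1. *)
Lemma symb_Cpower N : forall A, 0 <= A -> exists K, forall w, Cmod w <= A ->
  symb N (Re w) K (fun x => Cpower x w).
Proof.
assert (P : forall w K, 1 <= K -> forall x, 1 <= x ->
  Cmod (Cpower x w) <= K * Rpower x (Re w)).
{ intros w K HK x Hx. rewrite Cmod_Cpower. assert (h := Rpower_pos x (Re w)). nra. }
induction N as [|N IH]; intros A HA.
- exists 1. intros w _. split; [apply P; lra|exact I].
- destruct (IH (A + 1)) as [K HK]; [lra|]. exists (1 + A * K).
  assert (HK0 : 0 <= K).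
  { apply (symb_pos N (Re 0) K (fun x => Cpower x 0)), HK. rewrite Cmod_0. lra. }
  intros w Hw. split; [apply P; nra|].
  exists (fun x => w * Cpower x (w - 1))%C. split.
  + intros x Hx. apply derC_Cpower. lra.
  + apply symb_le with (Re w - 1) (Cmod w * K); [lra| |].
    * assert (h := Cmod_ge_0 w). nra.
    * apply symb_scal. replace (Re w - 1) with (Re (w - 1)%C) by (simpl; unfold Re; simpl; ring).
      apply HK. unfold Cminus. eapply Rle_trans; [apply Cmod_triangle|].
      rewrite Cmod_opp, Cmod_1. lra.
Qed.

Lemma symb_Cpower1 N w : exists K, 0 <= K /\ symb N (Re w) K (fun x => Cpower x w).
Proof.
destruct (symb_Cpower N (Cmod w) (Cmod_ge_0 w)) as [K HK].
exists K. assert (h := HK w (Rle_refl _)). split; auto. eapply symb_pos; eauto.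
Qed.

Lemma symb_ln N : exists K, symb N 1 K (fun x => RtoC (ln x)).
Proof.
destruct (symb_Cpower1 N (- (1))) as [K [HK H]]. exists (2 * K). apply symb_pred.
replace 1 with (0 + 1) at 1 by ring.
apply (symb_primitive _ _ _ _ (fun x => Cpower x (- (1)))); [lra| | |].
- rewrite ln_1. reflexivity.
- intros x Hx. apply derC_ln. lra.
- apply symb_le with (Re (- (1))%C) K; [simpl; lra|lra|exact H].
Qed.

(** Two integrations from 1, each releasing a factor h: x^(-h) - 1 has derivative -h x^(-h-1), and
    the remainder has derivative -h x^(-1) (x^(-h) - 1). The factor 1/x brings the degree back to 0
    between them, so the final degree is still 1. *)
Lemma symb_exp_remainder N : exists K, forall h, Cmod h <= 1 ->
  symb N 1 (K * Cmod h ^ 2) (fun x => Cpower x (- h) - 1 + h * RtoC (ln x))%C.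
Proof.
(* Both exponents that occur, -1 and -h - 1, have modulus at most 2. *)
destruct (symb_Cpower N 2) as [K2 H2]; [lra|].
assert (Hm1 : symb N (-1) K2 (fun x => Cpower x (- (1)))).
{ apply (symb_le N (Re (- (1))%C) K2); [simpl; lra|lra|].
  apply H2. rewrite Cmod_opp, Cmod_1. lra. }
assert (HK2 := symb_pos _ _ _ _ Hm1).
exists (2 * (2 ^ N * (K2 * (2 * K2)))). intros h Hh. assert (Hh0 := Cmod_ge_0 h).
assert (Hk : symb N 1 (2 * (Cmod h * K2)) (fun x => Cpower x (- h) - 1)%C).
{ apply symb_pred. replace 1 with (0 + 1) at 1 by ring.
  apply (symb_primitive _ _ _ _ (fun x => - h * Cpower x (- h - 1))%C); [lra| | |].
  - rewrite Cpower_1_l. ring.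
  - intros x Hx. eapply derC_eq; [|apply derC_minus;
      [apply derC_Cpower; lra|apply derC_const]]. ring.
  - rewrite <- (Cmod_opp h). apply symb_scal.
    apply (symb_le N (Re (- h - 1)%C) K2); [|lra|apply H2].
    + simpl. assert (h1 := re_le_Cmod h). assert (h2 := Rle_abs (- Re h)).
      rewrite Rabs_Ropp in h2. unfold Re in *; simpl. lra.
    + unfold Cminus. eapply Rle_trans; [apply Cmod_triangle|].
      rewrite !Cmod_opp, Cmod_1. lra. }
apply symb_pred. replace 1 with (0 + 1) at 1 by ring.
replace (2 * (2 ^ N * (K2 * (2 * K2))) * Cmod h ^ 2) with
  (2 * (Cmod (- h)%C * (2 ^ N * (K2 * (2 * (Cmod h * K2))))))
  by (rewrite Cmod_opp; ring).
apply (symb_primitive _ _ _ _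
  (fun x => - h * (Cpower x (- (1)) * (Cpower x (- h) - 1)))%C); [lra| | |].
- rewrite Cpower_1_l, ln_1. ring.
- intros x Hx. eapply derC_eq; [|apply derC_plus; [apply derC_minus;
      [apply derC_Cpower; lra|apply derC_const]|apply derC_scal, derC_ln; lra]].
  unfold Cminus. rewrite Cpower_plus. ring.
- apply symb_scal. replace 0 with (-1 + 1) by ring. apply symb_mult; assumption.
Qed.

Lemma ex_derive_of_quadratic (f : C -> C) z l K :
  (forall h, Cmod h <= 1 -> Cmod (f (z + h) - f z - h * l)%C <= K * Cmod h ^ 2) ->
  ex_derive (K := C_AbsRing) (V := C_NormedModule) f z.
Proof.
intros H. exists l. split.
- apply (is_linear_scal_l (K := C_AbsRing) (V := C_NormedModule) l).
- intros y Hy. assert (E : z = y).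
  { apply (is_filter_lim_locally_unique (K := C_AbsRing)
      (V := AbsRing_NormedModule C_AbsRing)). exact Hy. }
  subst y. clear Hy. intros eps.
  assert (HK : 0 < 1 + Rabs K) by (assert (h := Rabs_pos K); lra).
  (* The cap at 1 keeps the increment in the disc where the hypothesis holds; the absolute value
     covers a negative [K]. *)
  assert (Hd : 0 < Rmin 1 (eps / (1 + Rabs K))).
  { apply Rmin_pos; [lra|]. apply Rdiv_lt_0_compat; auto. apply cond_pos. }
  apply (locally_le_locally_norm (K := C_AbsRing) (V := AbsRing_NormedModule C_AbsRing)).
  exists (mkposreal _ Hd). intros y Hy. unfold ball_norm in Hy; simpl in Hy.
  change (Cmod ((f y - f z) - (y - z) * l)%C <= eps * Cmod (y - z)%C).
  change (Cmod (y - z)%C < Rmin 1 (eps / (1 + Rabs K))) in Hy.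
  assert (h1 := Rmin_l 1 (eps / (1 + Rabs K))). assert (h2 := Rmin_r 1 (eps / (1 + Rabs K))).
  assert (h3 := H (y - z)%C ltac:(lra)).
  assert (E : (z + ((y : C) - z) = y)%C) by (clear; revert y; intros y; change C in y; ring).
  rewrite E in h3. clear E.
  eapply Rle_trans; [exact h3|]. assert (h4 := Cmod_ge_0 (y - z)%C).
  assert (h5 := Rle_abs K).
  assert (h6 : (1 + Rabs K) * Cmod (y - z)%C <= eps).
  { apply Rle_trans with ((1 + Rabs K) * (eps / (1 + Rabs K))).
    - apply Rmult_le_compat_l; lra.
    - right. field. lra. }
  simpl. rewrite Rmult_1_r, <- Rmult_assoc. apply Rmult_le_compat_r; auto. nra.
Qed.

(** * The Dirichlet series of an antiperiodic sequence *)

Definition dirichlet (a : nat -> C) (z : C) : nat -> C := smp a (fun x => Cpower x (- z)).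

Lemma exists_nat_ge x : exists N : nat, x <= INR N.
Proof.
destruct (INR_unbounded x) as [N HN]. exists N. lra.
Qed.

Lemma dirichlet_reg_exists q a z N : antiperiodic q a -> - Re z - INR N <= -2 ->
  exists s, reg q N (dirichlet a z) s.
Proof.
intros Ha HN. destruct (symb_Cpower1 N (- z)) as [B [HB Hs]].
destruct (reg_symb q N (Re (- z)%C)) as [K [HK H]]; [exact HN|].
destruct (H a B _ Ha Hs) as [s [Hs1 _]]. exists s. exact Hs1.
Qed.

(** The required depth grows as Re z decreases, so the value is selected among all depths at
    once. *)
Definition zeta (q : nat) (a : nat -> C) (z : C) : C :=
  epsilon (inhabits (RtoC 0)) (fun s => exists N, reg q N (dirichlet a z) s).

(** The depth behind the selected value is unknown; it is compared with [N] at the larger of the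
    two, where uniqueness applies. *)
Lemma zeta_reg q a z N : antiperiodic q a -> - Re z - INR N <= -2 ->
  reg q N (dirichlet a z) (zeta q a z).
Proof.
intros Ha HN. destruct (dirichlet_reg_exists q a z N Ha HN) as [s Hs].
assert (He : exists N, reg q N (dirichlet a z) (zeta q a z)).
{ unfold zeta. apply epsilon_spec. exists s, N. exact Hs. }
destruct He as [N' HN'].
replace (zeta q a z) with s; auto.
apply (reg_unique q (Nat.max N N') (dirichlet a z)).
- apply reg_le with N; auto. lia.
- apply reg_le with N'; auto. lia.
Qed.

(** One Euler step reaches degree at most -2, and it can be undone because the terms are O(1/n).
    This includes the line Re z = 1, where absolute convergence fails. *)
Lemma zeta_convergent q a z : antiperiodic q a -> 1 <= Re z ->
  csum (dirichlet a z) (zeta q a z).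
Proof.
intros Ha Hz. apply csum_of_reg1 with q.
- intros eps He. destruct (exists_nat_ge (/ eps)) as [N HN]. exists N. intros n Hn.
  unfold dirichlet, smp. rewrite Cmod_mult, Cmod_Cpower.
  assert (h1 := INR_S_ge_1 n). assert (h2 := proj2 Ha n).
  assert (h3 : Rpower (INR (S n)) (Re (- z)%C) <= / INR (S n)).
  { rewrite <- (Rpower_1 (INR (S n))) at 2 by lra. rewrite <- Rpower_Ropp.
    apply Rle_Rpower; [lra|]. change (Re (- z)%C) with (- Re z). lra. }
  assert (h4 : / INR (S n) < eps).
  { rewrite <- (Rinv_inv eps). apply Rinv_lt_contravar.
    - apply Rmult_lt_0_compat; [apply Rinv_0_lt_compat; lra|lra].
    - apply le_INR in Hn. rewrite S_INR. lra. }
  assert (h5 := Rpower_pos (INR (S n)) (Re (- z)%C)). assert (h6 := Cmod_ge_0 (a n)). nra.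
- apply zeta_reg; auto. simpl. lra.
Qed.

Lemma zeta_entire q a : antiperiodic q a -> entire (zeta q a).
Proof.
intros Ha z.
(* Two units for absolute convergence and one for the degree of the logarithm; the latter also
   covers zeta at z + h for every |h| <= 1. *)
destruct (exists_nat_ge (- Re z + 3)) as [N HN].
destruct (symb_Cpower1 N (- z)) as [B [HB Hz]].
destruct (symb_ln N) as [B1 H1].
destruct (symb_exp_remainder N) as [K2 H2].
destruct (reg_symb q N (Re (- z)%C + 1)) as [K [HK HR]];
  [change (Re (- z)%C) with (- Re z); lra|].
(* [d] is the regularised sum of a_n ln n n^(-z), so the derivative of zeta at z is -d. *)
destruct (HR a _ _ Ha (symb_mult _ _ _ _ _ _ _ Hz H1)) as [d [Hd _]].
apply (ex_derive_of_quadratic (zeta q a) z (- d) (K * (2 ^ N * (B * K2)))).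
intros h Hh.
destruct (HR a _ _ Ha (symb_mult _ _ _ _ _ _ _ Hz (H2 h Hh))) as [e [He He']].
replace (zeta q a (z + h) - zeta q a z - h * - d)%C with e.
{ eapply Rle_trans; [exact He'|]. right. ring. }
apply (reg_unique q N (smp a (fun x => Cpower x (- z) *
  (Cpower x (- h) - 1 + h * RtoC (ln x)))%C)); [exact He|].
replace (zeta q a (z + h) - zeta q a z - h * - d)%C with
  (zeta q a (z + h) + (- (1)) * zeta q a z + h * d)%C by ring.
eapply reg_ext; [|apply reg_plus; [apply reg_plus; [apply zeta_reg; auto|
  apply reg_scal, zeta_reg; auto]|apply reg_scal, Hd]].
- intros n. unfold dirichlet, smp.
  replace (- (z + h))%C with (- z + - h)%C by ring. rewrite Cpower_plus. ring.
- assert (h1 := re_le_Cmod h). assert (h2 := Rle_abs (- Re h)).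
  rewrite Rabs_Ropp in h2. change (Re (z + h)%C) with (Re z + Re h). lra.
- lra.
Qed.

(** * Riesz weights and Cesaro summation *)

Definition cut (X : R) (m : nat) (x : R) : C := RtoC (Rmax 0 (1 - x / X) ^ m).

(** The exponent is at least 2, so the one-sided derivatives agree at the corner u = 0. *)
Lemma is_derive_pos_part_pow m u :
  is_derive (fun v => Rmax 0 v ^ S (S m)) u (INR (S (S m)) * Rmax 0 u ^ S m).
Proof.
destruct (Rtotal_order u 0) as [Hu|[Hu|Hu]].
- apply (is_derive_ext_loc (fun _ => 0)).
  + exists (mkposreal (- u) ltac:(lra)). intros v Hv.
    change (Rabs (v - u) < - u) in Hv. apply Rabs_def2 in Hv.
    rewrite Rmax_left by lra. simpl. ring.
  + eapply is_derive_eq; [|apply (is_derive_const (K := R_AbsRing) (V := R_NormedModule))].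
    rewrite Rmax_left by lra. simpl. unfold zero; simpl. ring.
- subst u. rewrite Rmax_left by lra.
  apply is_derive_Reals. intros eps He.
  exists (mkposreal (Rmin 1 eps) ltac:(apply Rmin_pos; lra)).
  intros h Hh Hlt. simpl in Hlt. rewrite Rplus_0_l, (Rmax_left 0 0) by lra.
  assert (h1 := Rmin_l 1 eps). assert (h2 := Rmin_r 1 eps).
  (* The innermost quotient is 0 or 1 according to the sign of h, which leaves a factor of size at
     most |h|. *)
  replace ((Rmax 0 h ^ S (S m) - 0 ^ S (S m)) / h - INR (S (S m)) * 0 ^ S m)
    with (Rmax 0 h ^ m * (Rmax 0 h * (Rmax 0 h / h))) by (simpl; field; exact Hh).
  destruct (Rle_dec h 0) as [Hle|Hgt].
  + rewrite (Rmax_left 0 h) by lra. rewrite Rmult_0_l, Rmult_0_r, Rabs_R0. exact He.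
  + rewrite (Rmax_right 0 h) by lra. replace (h / h) with 1 by (field; exact Hh).
    rewrite Rabs_pos_eq in * by lra.
    assert (h3 : 0 <= h ^ m <= 1).
    { split; [apply pow_le; lra|]. rewrite <- (pow1 m). apply pow_incr. lra. }
    rewrite Rabs_pos_eq by nra. nra.
- apply (is_derive_ext_loc (fun v => v ^ S (S m))).
  + exists (mkposreal u Hu). intros v Hv.
    change (Rabs (v - u) < u) in Hv. apply Rabs_def2 in Hv.
    rewrite Rmax_right by lra. reflexivity.
  + rewrite Rmax_right by lra.
    eapply is_derive_eq; [|apply (is_derive_pow (fun v => v)), @is_derive_id].
    change (INR (S (S m)) * 1 * u ^ S m = INR (S (S m)) * u ^ S m). ring.
Qed.

Lemma derC_cut X m x : 0 < X ->
  derC (cut X (S (S m))) x (RtoC (- (INR (S (S m)) / X)) * cut X (S m) x)%C.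
Proof.
intros HX. unfold cut.
eapply derC_eq; [|apply derC_RtoC;
  apply (is_derive_comp (fun v => Rmax 0 v ^ S (S m)) (fun x => 1 - x / X));
  [apply is_derive_pos_part_pow|]].
2: { instantiate (1 := - / X). auto_derive; [lra|field; lra]. }
rewrite <- RtoC_mult. f_equal.
change (- / X * (INR (S (S m)) * Rmax 0 (1 - x / X) ^ S m) =
  - (INR (S (S m)) / X) * Rmax 0 (1 - x / X) ^ S m). field. lra.
Qed.

Lemma pos_part_bounds X x : 0 < X -> 0 <= x -> 0 <= Rmax 0 (1 - x / X) <= 1.
Proof.
intros HX Hx. split; [apply Rmax_l|]. apply Rmax_lub; [lra|].
assert (0 <= x / X) by (apply Rdiv_le_0_compat; auto). lra.
Qed.

Lemma cut_bound X m x : 0 < X -> 0 <= x -> Cmod (cut X m x) <= 1.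
Proof.
intros HX Hx. assert (h := pos_part_bounds X x HX Hx).
unfold cut. rewrite Cmod_R, Rabs_pos_eq by (apply pow_le; lra).
apply Rle_trans with (1 ^ m); [apply pow_incr, h|rewrite pow1; lra].
Qed.

Lemma cut_0 X m x : 0 < X -> X <= x -> cut X (S m) x = 0%C.
Proof.
intros HX Hx. unfold cut. rewrite Rmax_left.
- simpl. rewrite Rmult_0_l. reflexivity.
- assert (1 <= x / X).
  { apply Rmult_le_reg_r with X; auto. field_simplify; lra. }
  lra.
Qed.

(* On the support of the cut-off, [1 / X <= 1 / x]. *)
Lemma symb_cut N : forall m i, (N < m)%nat -> exists B, forall X, 0 < X ->
  symb N (- INR i) B (fun x => RtoC ((/ X) ^ i) * cut X m x)%C.
Proof.
assert (P : forall m i B, (0 < m)%nat -> 1 <= B -> forall X, 0 < X -> forall x, 1 <= x ->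
  Cmod (RtoC ((/ X) ^ i) * cut X m x)%C <= B * Rpower x (- INR i)).
{ intros [|m] i B Hm HB X HX x Hx; [lia|].
  assert (h1 := Rpower_pos x (- INR i)).
  destruct (Rle_dec X x) as [Hle|Hlt].
  - rewrite cut_0 by auto. rewrite Cmult_0_r, Cmod_0. nra.
  - assert (h2 := cut_bound X (S m) x HX ltac:(lra)).
    rewrite Cmod_mult, Cmod_R.
    assert (h3 : (/ X) ^ i <= Rpower x (- INR i)).
    { rewrite Rpower_Ropp, Rpower_pow by lra. rewrite <- pow_inv.
      apply pow_incr. split; [apply Rlt_le, Rinv_0_lt_compat; auto|].
      apply Rinv_le_contravar; lra. }
    assert (h4 : 0 <= (/ X) ^ i) by (apply pow_le, Rlt_le, Rinv_0_lt_compat; auto).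
    rewrite Rabs_pos_eq by auto. assert (h5 := Cmod_ge_0 (cut X (S m) x)).
    apply Rle_trans with (Rpower x (- INR i) * 1).
    + apply Rmult_le_compat; auto.
    + nra. }
induction N as [|N IH]; intros m i Hm.
- exists 1. intros X HX. split; [apply P; [lia|lra|auto]|exact I].
- destruct m as [|[|m]]; [lia|lia|].
  (* Differentiation lowers the exponent by one and releases a factor 1/X, which is absorbed by
     raising [i]. *)
  destruct (IH (S m) (S i)) as [B HB]; [lia|].
  exists (1 + INR (S (S m)) * B). intros X HX.
  assert (HB0 := symb_pos _ _ _ _ (HB X HX)). assert (hm := pos_INR (S (S m))).
  split; [apply P; [lia|nra|auto]|].
  exists (fun x => RtoC (- INR (S (S m))) * (RtoC ((/ X) ^ S i) * cut X (S m) x))%C. split.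
  + intros x Hx. eapply derC_eq; [|apply derC_scal, derC_cut, HX].
    rewrite !Cmult_assoc, <- !RtoC_mult. do 2 f_equal. simpl. field. lra.
  + apply symb_le with (- INR (S i)) (Cmod (RtoC (- INR (S (S m)))) * B).
    * rewrite (S_INR i). lra.
    * rewrite Cmod_R, Rabs_Ropp, Rabs_pos_eq by auto. lra.
    * apply symb_scal, HB, HX.
Qed.

(** The value is bounded by Bernoulli's inequality 1 - v^k <= k (1 - v) with 1 - v <= x/X. The
    derivative is 1/X times a lower power of the cut-off, whose symbol norm in degree 0 is uniform
    in X. *)
Lemma symb_cut_minus_1 N m : (N < m)%nat -> exists B, forall X, 0 < X ->
  symb (S N) 1 (B / X) (fun x => cut X (S m) x - 1)%C.
Proof.
intros Hm. destruct m as [|m]; [lia|].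
destruct (symb_cut N (S m) 0 Hm) as [B HB].
assert (hm := pos_INR (S (S m))).
exists (INR (S (S m)) * (1 + B)). intros X HX. assert (HB0 := symb_pos _ _ _ _ (HB X HX)).
assert (HiX : 0 < / X) by (apply Rinv_0_lt_compat; auto).
split.
- intros x Hx. rewrite Rpower_1 by lra.
  assert (hp := pos_part_bounds X x HX ltac:(lra)).
  unfold cut. rewrite <- RtoC_minus, Cmod_R.
  assert (Hv : 1 - Rmax 0 (1 - x / X) <= x / X) by (assert (h := Rmax_r 0 (1 - x / X)); lra).
  set (v := Rmax 0 (1 - x / X)) in *.
  assert (Hb : forall k, 0 <= 1 - v ^ k <= INR k * (1 - v)).
  { induction k as [|k IHk].
    - simpl. lra.
    - rewrite S_INR. simpl pow. split.
      + assert (0 <= v ^ k) by (apply pow_le; lra). nra.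
      + nra. }
  specialize (Hb (S (S m))). rewrite Rabs_left1 by lra.
  apply Rle_trans with (INR (S (S m)) * (x / X)); [nra|].
  assert (h : 0 <= INR (S (S m)) * B * (x / X)).
  { apply Rmult_le_pos; [apply Rmult_le_pos; auto|apply Rdiv_le_0_compat; lra]. }
  unfold Rdiv in *. nra.
- exists (fun x => RtoC (- (INR (S (S m)) / X)) * cut X (S m) x)%C. split.
  + intros x Hx. eapply derC_eq; [|apply derC_minus; [apply derC_cut, HX|apply derC_const]].
    ring.
  + apply symb_le with (- INR 0) (Cmod (RtoC (- (INR (S (S m)) / X))) * B).
    * simpl. lra.
    * rewrite Cmod_R, Rabs_Ropp, Rabs_pos_eq by (apply Rdiv_le_0_compat; auto).
      unfold Rdiv. assert (0 <= INR (S (S m)) * / X) by nra. nra.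
    * apply symb_scal. eapply symb_ext; [|apply HB, HX]. intros x. simpl. ring.
Qed.

Lemma sum_n_m_psum (u : nat -> C) n :
  sum_n_m (G := C_AbelianMonoid) u 1 n = psum (fun k => u (S k)) n.
Proof.
induction n as [|n IH].
- apply (sum_n_m_zero (G := C_AbelianMonoid)). lia.
- rewrite sum_n_Sm by lia. rewrite IH. reflexivity.
Qed.

(** The weight vanishes from X on, so the finite mean is an infinite series of samples of a symbol,
    to which the regularised calculus applies. *)
Lemma cesaro_mean_csum a z t X m : (forall n, t (S n) = dirichlet a z n) -> 0 < X ->
  csum (smp a (fun x => Cpower x (- z) * cut X (S m) x)%C) (cesaro_mean (S m) t X).
Proof.
intros Ht HX. unfold cesaro_mean. rewrite sum_n_m_psum.
set (n := Z.to_nat (up X)).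
replace (psum _ n) with (psum (smp a (fun x => Cpower x (- z) * cut X (S m) x)%C) n).
- apply csum_finite. intros k Hk. unfold smp. rewrite cut_0; [ring|auto|].
  assert (h := archimed X). apply le_INR in Hk. rewrite S_INR.
  assert (h' : IZR (up X) <= INR n).
  { unfold n. rewrite INR_IZR_INZ. apply IZR_le. lia. }
  lra.
- apply psum_ext. intros k _. unfold smp. destruct (Rlt_dec (INR (S k)) X) as [Hlt|Hge].
  + rewrite Ht. unfold dirichlet, smp, cut. rewrite Rmax_right.
    * ring.
    * assert (INR (S k) / X <= 1).
      { apply Rmult_le_reg_r with X; auto. field_simplify; lra. }
      lra.
  + rewrite cut_0 by lra. ring.
Qed.

Lemma zeta_cesaro q a z t : antiperiodic q a -> (forall n, t (S n) = dirichlet a z n) ->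
  cesaro_sum t (zeta q a z).
Proof.
intros Ha Ht.
destruct (exists_nat_ge (- Re z + 3)) as [N HN].
destruct (symb_Cpower1 (S N) (- z)) as [B [HB Hz]].
destruct (symb_cut_minus_1 N (S N)) as [B1 H1]; [lia|].
destruct (reg_symb q (S N) (Re (- z)%C + 1)) as [K [HK HR]];
  [rewrite S_INR; change (Re (- z)%C) with (- Re z); lra|].
(* The power N + 2 of the cut-off has the N + 1 derivatives consumed by N + 1 Euler steps. *)
exists (S (S N)). apply (filterlim_C (Rbar_locally p_infty)). intros eps He.
assert (HB1 : 0 <= B1).
{ assert (h := symb_pos _ _ _ _ (H1 1 Rlt_0_1)). lra. }
set (M := K * (2 ^ S N * (B * B1))).
assert (HM : 0 <= M).
{ assert (0 < 2 ^ S N) by (apply pow_lt; lra). unfold M.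
  apply Rmult_le_pos; [lra|apply Rmult_le_pos; [lra|apply Rmult_le_pos; lra]]. }
exists (Rmax 1 (M / eps)). intros X HX.
assert (h1 := Rmax_l 1 (M / eps)). assert (h2 := Rmax_r 1 (M / eps)).
destruct (HR a _ _ Ha (symb_mult _ _ _ _ _ _ _ Hz (H1 X ltac:(lra)))) as [e [He1 He2]].
replace (cesaro_mean (S (S N)) t X - zeta q a z)%C with e.
- eapply Rle_lt_trans; [exact He2|].
  replace (K * (2 ^ S N * (B * (B1 / X)))) with (M / X) by (unfold M; field; lra).
  apply Rmult_lt_reg_r with X; [lra|]. unfold Rdiv. rewrite Rmult_assoc, Rinv_l by lra.
  apply Rmult_lt_reg_r with (/ eps); [apply Rinv_0_lt_compat; auto|].
  replace (eps * X * / eps) with X by (field; lra). rewrite Rmult_1_r.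
  unfold Rdiv in *. lra.
- apply (reg_unique q (S N) _ _ _ He1).
  replace (cesaro_mean (S (S N)) t X - zeta q a z)%C with
    (cesaro_mean (S (S N)) t X + - (1) * zeta q a z)%C by ring.
  eapply reg_ext; [|apply reg_plus; [apply (reg_le q 0 (S N)); [lia|];
    apply (cesaro_mean_csum a z t X (S N) Ht); lra|
    apply reg_scal, zeta_reg; [exact Ha|rewrite S_INR; lra]]].
  intros n. unfold dirichlet, smp. ring.
Qed.

(** * The orbit of 1 and the quadratic phases *)

Definition odd_ratio (w : Rhat) : Prop :=
  exists nu j : Z, w = Some (IZR (2 * nu + 1) / IZR (2 * j + 1)).

Lemma IZR_odd_neq_0 k : IZR (2 * k + 1) <> 0.
Proof. apply not_0_IZR. lia. Qed.

(** Translation by 2 adds twice the denominator to the numerator, and inversion exchanges them up to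
    sign. Oddness of both persists, so the orbit meets neither 0 nor infinity. *)
Lemma theta_group_odd_ratio g : theta_group g -> odd_ratio (g (Some 1)).
Proof.
induction 1 as [|g _ [nu [j E]]|g _ [nu [j E]]|g _ [nu [j E]]].
- exists 0%Z, 0%Z. simpl. f_equal. field.
- rewrite E. exists (nu + 2 * j + 1)%Z, j. unfold translate, option_map. f_equal.
  assert (h := IZR_odd_neq_0 j).
  replace (2 * (nu + 2 * j + 1) + 1)%Z with (2 * nu + 1 + 2 * (2 * j + 1))%Z by ring.
  rewrite (plus_IZR (2 * nu + 1)), (mult_IZR 2 (2 * j + 1)). field. exact h.
- rewrite E. exists (nu - 2 * j - 1)%Z, j. unfold translate, option_map. f_equal.
  assert (h := IZR_odd_neq_0 j).
  replace (2 * (nu - 2 * j - 1) + 1)%Z with (2 * nu + 1 - 2 * (2 * j + 1))%Z by ring.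
  rewrite minus_IZR, (mult_IZR 2 (2 * j + 1)). field. exact h.
- rewrite E. exists (- j - 1)%Z, nu. unfold neg_inv.
  assert (h := IZR_odd_neq_0 j). assert (h' := IZR_odd_neq_0 nu).
  destruct (Req_EM_T _ 0) as [E0|_].
  + exfalso. apply h'. apply Rmult_eq_reg_r with (/ IZR (2 * j + 1)).
    * rewrite Rmult_0_l. exact E0.
    * apply Rinv_neq_0_compat, h.
  + f_equal. replace (2 * (- j - 1) + 1)%Z with (- (2 * j + 1))%Z by ring.
    rewrite opp_IZR. field. auto.
Qed.

Lemma S1_translate w : S1 w -> S1 (translate 2 w).
Proof.
intros [g [Hg ->]]. exists (fun w => translate 2 (g w)). split; auto. now constructor.
Qed.

Lemma S1_untranslate w : S1 w -> S1 (translate (-2) w).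
Proof.
intros [g [Hg ->]]. exists (fun w => translate (-2) (g w)). split; auto. now constructor.
Qed.

Lemma S1_neg_inv w : S1 w -> S1 (neg_inv w).
Proof.
intros [g [Hg ->]]. exists (fun w => neg_inv (g w)). split; auto. now constructor.
Qed.

Lemma S1_translate_even k x : S1 (Some x) -> S1 (Some (x + 2 * IZR k)).
Proof.
intros H.
assert (P : forall n, S1 (Some (x + 2 * INR n)) /\ S1 (Some (x - 2 * INR n))).
{ induction n as [|n [I1 I2]].
  - simpl. rewrite Rmult_0_r, Rplus_0_r, Rminus_0_r. auto.
  - split; rewrite S_INR.
    + replace (x + 2 * (INR n + 1)) with (x + 2 * INR n + 2) by ring.
      apply (S1_translate _ I1).
    + replace (x - 2 * (INR n + 1)) with (x - 2 * INR n + -2) by ring.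
      apply (S1_untranslate _ I2). }
destruct (Z_le_dec 0 k) as [Hk|Hk].
- destruct (P (Z.to_nat k)) as [I1 _]. rewrite INR_IZR_INZ, Z2Nat.id in I1 by exact Hk.
  exact I1.
- destruct (P (Z.to_nat (- k))) as [_ I2]. rewrite INR_IZR_INZ, Z2Nat.id in I2 by lia.
  rewrite opp_IZR in I2. replace (x + 2 * IZR k) with (x - 2 * - IZR k) by ring. exact I2.
Qed.

(* Euclid's algorithm with even quotients: subtracting an even integer makes the numerator
   smaller than the denominator, and the inversion exchanges the two. *)
Lemma S1_odd_ratio_bounded n : forall nu j, (Z.abs (2 * j + 1) <= Z.of_nat n)%Z ->
  S1 (Some (IZR (2 * nu + 1) / IZR (2 * j + 1))).
Proof.
induction n as [|n IH]; intros nu j Hj; [lia|].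
set (q := (2 * j + 1)%Z) in *.
assert (hq : IZR q <> 0) by apply IZR_odd_neq_0.
(* Centred division: adding q before dividing by 2|q| and subtracting |q| from the remainder puts
   the new numerator in [-|q|, |q|]. *)
assert (Hred : exists k nu', (2 * nu + 1 = 2 * nu' + 1 + 2 * k * q)%Z /\
  (Z.abs (2 * nu' + 1) <= Z.abs q)%Z).
{ pose (s := (2 * nu + 1 + q)%Z).
  assert (Hm := Z.mod_pos_bound s (2 * Z.abs q) ltac:(lia)).
  assert (He := Z.div_mod s (2 * Z.abs q) ltac:(lia)).
  set (m := (s mod (2 * Z.abs q))%Z) in *. set (d := (s / (2 * Z.abs q))%Z) in *.
  destruct (Z_le_dec 0 q) as [H0|H0].
  - rewrite (Z.abs_eq q) in * by lia.
    exists d, (nu - d * q)%Z. split; [ring|].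
    replace (2 * (nu - d * q) + 1)%Z with (m - q)%Z by (unfold s in He; lia). lia.
  - rewrite (Z.abs_neq q) in * by lia.
    exists (- d - 1)%Z, (nu + d * q + q)%Z. split; [ring|].
    replace (2 * (nu + d * q + q) + 1)%Z with (m + q)%Z by (unfold s in He; lia). lia. }
destruct Hred as [k [nu' [E Hle]]].
rewrite E, plus_IZR, !mult_IZR.
replace ((IZR (2 * nu' + 1) + 2 * IZR k * IZR q) / IZR q)
  with (IZR (2 * nu' + 1) / IZR q + 2 * IZR k) by (field; exact hq).
apply S1_translate_even. clear E k.
assert (hp := IZR_odd_neq_0 nu').
(* When the absolute values agree the descent stops: the ratio is 1, or -1 = 1 - 2. *)
destruct (Z.eq_dec (Z.abs (2 * nu' + 1)) (Z.abs q)) as [Heq|Hne].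
- assert (Hone : S1 (Some 1)) by (exists (fun w => w); split; [constructor|reflexivity]).
  assert (Hpq : (2 * nu' + 1 = q \/ 2 * nu' + 1 = - q)%Z) by lia.
  destruct Hpq as [E|E]; rewrite E.
  + replace (IZR q / IZR q) with 1 by (field; exact hq). exact Hone.
  + rewrite opp_IZR.
    replace (- IZR q / IZR q) with (1 + 2 * IZR (-1)) by (field; exact hq).
    apply S1_translate_even, Hone.
(* The induction hypothesis is used for -q/p', which the inversion sends to p'/q. *)
- assert (HI := IH (- j - 1)%Z nu' ltac:(lia)).
  replace (2 * (- j - 1) + 1)%Z with (- q)%Z in HI by (unfold q; ring).
  rewrite opp_IZR in HI. apply S1_neg_inv in HI. unfold neg_inv in HI.
  destruct (Req_EM_T _ 0) as [E0|_].
  + exfalso. apply hq. apply Rmult_eq_reg_r with (- / IZR (2 * nu' + 1)).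
    * rewrite Rmult_0_l, <- E0. field. exact hp.
    * apply Ropp_neq_0_compat, Rinv_neq_0_compat, hp.
  + replace (IZR (2 * nu' + 1) / IZR q) with (-1 / (- IZR q / IZR (2 * nu' + 1)))
      by (field; auto).
    exact HI.
Qed.

Lemma S1_iff_odd_ratio w : S1 w <-> odd_ratio w.
Proof.
split.
- intros [g [Hg ->]]. apply theta_group_odd_ratio, Hg.
- intros [nu [j ->]]. apply (S1_odd_ratio_bounded (Z.abs_nat (2 * j + 1))). lia.
Qed.

Definition cis (x : R) : C := (cos x, sin x).

Lemma Cexp_Ci x : Cexp (Ci * RtoC x) = cis x.
Proof.
unfold Cexp, cis, Re, Im. simpl.
replace (0 * x - 1 * 0) with 0 by ring. replace (0 * 0 + 1 * x) with x by ring.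
rewrite exp_0. f_equal; ring.
Qed.

Lemma cis_plus x y : cis (x + y) = (cis x * cis y)%C.
Proof. unfold cis. rewrite cos_plus, sin_plus. apply injective_projections; simpl; ring. Qed.

Lemma Cmod_cis x : Cmod (cis x) = 1.
Proof. rewrite <- Cexp_Ci, Cmod_Cexp. simpl. rewrite <- exp_0. f_equal. ring. Qed.

Lemma cis_2PI k : cis (2 * IZR k * PI) = 1%C.
Proof.
assert (P : forall n, cis (2 * INR n * PI) = 1%C).
{ intros n. unfold cis. rewrite <- (Rplus_0_l (2 * INR n * PI)).
  rewrite cos_period, sin_period, cos_0, sin_0. reflexivity. }
destruct (Z_le_dec 0 k) as [Hk|Hk].
- rewrite <- (P (Z.to_nat k)), INR_IZR_INZ, Z2Nat.id by exact Hk. reflexivity.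
- assert (h := P (Z.to_nat (- k))). rewrite INR_IZR_INZ, Z2Nat.id, opp_IZR in h by lia.
  assert (h' := cis_plus (2 * IZR k * PI) (2 * - IZR k * PI)).
  rewrite h in h'. replace (2 * IZR k * PI + 2 * - IZR k * PI) with 0 in h' by ring.
  rewrite Cmult_1_r in h'. rewrite <- h'. unfold cis. rewrite cos_0, sin_0. reflexivity.
Qed.

Lemma cis_odd k : cis (IZR (2 * k + 1) * PI) = (- (1))%C.
Proof.
rewrite plus_IZR, mult_IZR.
replace ((2 * IZR k + 1) * PI) with (2 * IZR k * PI + PI) by ring.
rewrite cis_plus, cis_2PI. unfold cis. rewrite cos_PI, sin_PI.
apply injective_projections; simpl; ring.
Qed.

(** Indexed as in [smp]: the entry [n] belongs to the integer n + 1. *)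
Definition gauss (r : R) (n : nat) : C := cis (PI * r * INR (S n) ^ 2).

(* With [r q = p] and [p], [q] odd, [r (n + q)^2 - r n^2 = 2 p n + p q] is an odd integer. *)
Lemma gauss_antiperiodic nu j :
  antiperiodic (Z.abs_nat (2 * j + 1)) (gauss (IZR (2 * nu + 1) / IZR (2 * j + 1))).
Proof.
split; [|intros n; unfold gauss; rewrite Cmod_cis; lra].
intros n. unfold gauss. set (q := Z.abs_nat (2 * j + 1)).
assert (h := IZR_odd_neq_0 j).
(* The period is the absolute value of the denominator; for a negative denominator the sign moves to
   the numerator, which stays odd. *)
assert (Hq : exists l m, INR q = IZR (2 * l + 1) /\
  IZR (2 * nu + 1) / IZR (2 * j + 1) * INR q = IZR (2 * m + 1)).
{ unfold q. rewrite INR_IZR_INZ, Zabs2Nat.id_abs.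
  destruct (Z.abs_eq_or_opp (2 * j + 1)) as [E|E]; rewrite E.
  - exists j, nu. split; auto. field. exact h.
  - exists (- j - 1)%Z, (- nu - 1)%Z.
    replace (2 * (- j - 1) + 1)%Z with (- (2 * j + 1))%Z by ring.
    replace (2 * (- nu - 1) + 1)%Z with (- (2 * nu + 1))%Z by ring.
    split; auto. rewrite !opp_IZR. field. exact h. }
destruct Hq as [l [m [E1 E2]]].
set (r := IZR (2 * nu + 1) / IZR (2 * j + 1)) in *.
replace (INR (S (n + q))) with (INR (S n) + INR q)
  by (rewrite <- plus_INR; f_equal; lia).
set (N := Z.of_nat (S n)).
assert (EN : INR (S n) = IZR N) by (unfold N; apply INR_IZR_INZ).
replace (PI * r * (INR (S n) + INR q) ^ 2) with
  (PI * r * INR (S n) ^ 2 + (2 * (r * INR q) * INR (S n) + (r * INR q) * INR q) * PI) by ring.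
rewrite cis_plus, E2, EN, E1.
replace (2 * IZR (2 * m + 1) * IZR N + IZR (2 * m + 1) * IZR (2 * l + 1)) with
  (IZR (2 * ((2 * m + 1) * N + m * (2 * l + 1) + l) + 1)).
- rewrite cis_odd. ring.
- rewrite <- !mult_IZR, <- plus_IZR. f_equal. ring.
Qed.

Lemma zeta_term_dirichlet r z n : zeta_term r z (S n) = dirichlet (gauss r) z n.
Proof.
unfold zeta_term, dirichlet, smp, gauss. rewrite Cexp_Ci. unfold Cdiv. f_equal.
assert (E : (Cpower (INR (S n)) z * Cpower (INR (S n)) (- z) = 1)%C).
{ rewrite <- Cpower_plus. replace (z + - z)%C with (RtoC 0) by ring. apply Cpower_0. }
assert (Hn : Cpower (INR (S n)) z <> 0%C).
{ intros E0. rewrite E0 in E. rewrite Cmult_0_l in E. apply (f_equal fst) in E.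
  simpl in E. lra. }
rewrite <- (Cmult_1_r (/ _)), <- E, Cmult_assoc, Cinv_l, Cmult_1_l by exact Hn.
reflexivity.
Qed.

(** * Integrals over the real line *)

Definition contC (f : R -> C) : Prop :=
  forall t : R, continuous (fun s => Re (f s)) t /\ continuous (fun s => Im (f s)) t.

Lemma contC_derC f f' : (forall t, derC f t (f' t)) -> contC f.
Proof.
intros H t. destruct (H t) as [H1 H2].
split; apply (ex_derive_continuous (K := R_AbsRing) (V := R_NormedModule)); eexists; eassumption.
Qed.

Lemma contC_const c : contC (fun _ => c).
Proof. intros t. split; apply continuous_const. Qed.

Lemma contC_plus f g : contC f -> contC g -> contC (fun t => f t + g t)%C.
Proof.
intros Hf Hg t. destruct (Hf t), (Hg t).
split; apply (continuous_plus (K := R_AbsRing) (V := R_NormedModule)); assumption.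
Qed.

Lemma contC_mult f g : contC f -> contC g -> contC (fun t => f t * g t)%C.
Proof.
intros Hf Hg t. destruct (Hf t), (Hg t). split.
- apply (continuous_minus (K := R_AbsRing) (V := R_NormedModule)
    (fun s => Re (f s) * Re (g s)) (fun s => Im (f s) * Im (g s)));
  apply (continuous_mult (K := R_AbsRing)); assumption.
- apply (continuous_plus (K := R_AbsRing) (V := R_NormedModule)
    (fun s => Re (f s) * Im (g s)) (fun s => Im (f s) * Re (g s)));
  apply (continuous_mult (K := R_AbsRing)); assumption.
Qed.

(** An improper integral through a global primitive with limits at both ends. Linearity and affine
    substitution become statements about the primitive. *)
Definition has_integral (f : R -> C) (l : C) : Prop :=
  exists (G : R -> C) (la lb : C),
    (forall t, derC G t (f t)) /\
    filterlim G (Rbar_locally m_infty) (locally la) /\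
    filterlim G (Rbar_locally p_infty) (locally lb) /\
    l = (lb - la)%C.

Lemma is_RInt_gen_integral (f : R -> C) (l : C) :
  is_RInt_gen (V := C_R_CompleteNormedModule) f (Rbar_locally m_infty) (Rbar_locally p_infty) l ->
  integral f = l.
Proof.
exact (@is_RInt_gen_unique C_R_CompleteNormedModule (Rbar_locally m_infty)
  (Rbar_locally p_infty) (Proper_StrongProper _ (Rbar_locally_filter _))
  (Proper_StrongProper _ (Rbar_locally_filter _)) f l).
Qed.

Lemma has_integral_integral f l : contC f -> has_integral f l -> integral f = l.
Proof.
intros Hc [G [la [lb [HG [Ha [Hb ->]]]]]].
apply is_RInt_gen_integral.
intros P HP.
assert (Hlim : filterlim (fun ab : R * R => G (snd ab) - G (fst ab))%C
  (filter_prod (Rbar_locally m_infty) (Rbar_locally p_infty)) (locally (lb - la)%C)).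
{ apply filterlim_C; [typeclasses eauto|]. intros eps He.
  apply (Filter_prod _ _ _ (fun a => Cmod (G a - la)%C < eps / 2)
    (fun b => Cmod (G b - lb)%C < eps / 2)).
  - apply (proj1 (filterlim_C (Rbar_locally m_infty) G la) Ha). lra.
  - apply (proj1 (filterlim_C (Rbar_locally p_infty) G lb) Hb). lra.
  - intros a b h1 h2. simpl.
    replace (G b - G a - (lb - la))%C with ((G b - lb) + - (G a - la))%C by ring.
    eapply Rle_lt_trans; [apply Cmod_triangle|]. rewrite Cmod_opp. lra. }
specialize (Hlim P HP). unfold filtermap in Hlim. unfold filtermapi.
revert Hlim. apply filter_imp. intros [a b] Hab. simpl in *.
exists (G b - G a)%C. split; auto.
apply (is_RInt_fct_extend_pair (U := R_NormedModule) (V := R_NormedModule)).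
- apply (is_RInt_derive (V := R_CompleteNormedModule) (fun t => Re (G t)) (fun t => Re (f t))).
  + intros x _. apply HG.
  + intros x _. apply Hc.
- apply (is_RInt_derive (V := R_CompleteNormedModule) (fun t => Im (G t)) (fun t => Im (f t))).
  + intros x _. apply HG.
  + intros x _. apply Hc.
Qed.

(** B atan - u and B atan + u are both nondecreasing. The bounded function atan thus replaces an
    absolutely integrable majorant. *)
Lemma atan_dominates (u u' : R -> R) B x y :
  (forall t, is_derive u t (u' t)) -> (forall t, (1 + t ^ 2) * Rabs (u' t) <= B) ->
  x <= y -> Rabs (u y - u x) <= B * (atan y - atan x).
Proof.
intros Hu HB Hxy.
assert (P : forall s, (s = 1 \/ s = -1) -> s * (u y - u x) <= B * (atan y - atan x)).
{ intros s Hs.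
  destruct (MVT_gen (fun t => B * atan t - s * u t) x y
    (fun t => B * / (1 + t ^ 2) - s * u' t)) as [c [_ E]].
  - intros t _. apply @is_derive_minus.
    + apply (is_derive_scal atan t B), is_derive_Reals, derivable_pt_lim_atan.
    + apply (is_derive_scal u t s), Hu.
  - intros t _. apply derivable_continuous_pt, ex_derive_Reals_0.
    apply @ex_derive_minus.
    + apply ex_derive_scal. exists (/ (1 + t ^ 2)). apply is_derive_Reals, derivable_pt_lim_atan.
    + apply ex_derive_scal. exists (u' t). apply Hu.
  - assert (h : 0 <= B * / (1 + c ^ 2) - s * u' c).
    { assert (h1 : 0 < 1 + c ^ 2) by nra.
      apply Rmult_le_reg_l with (1 + c ^ 2); auto. rewrite Rmult_0_r.
      replace ((1 + c ^ 2) * (B * / (1 + c ^ 2) - s * u' c))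
        with (B - (1 + c ^ 2) * (s * u' c)) by (field; lra).
      assert (h2 : s * u' c <= Rabs (u' c)).
      { assert (h3 := Rle_abs (u' c)). assert (h4 := Rle_abs (- u' c)).
        rewrite Rabs_Ropp in h4. destruct Hs as [-> | ->]; lra. }
      specialize (HB c). nra. }
    nra. }
apply Rabs_le. assert (h1 := P 1 (or_introl eq_refl)). assert (h2 := P (-1) (or_intror eq_refl)).
lra.
Qed.

Lemma atan_cauchy eps : 0 < eps ->
  (exists M, forall x y, M < x -> M < y -> Rabs (atan y - atan x) < eps) /\
  (exists M, forall x y, x < M -> y < M -> Rabs (atan y - atan x) < eps).
Proof.
intros He. assert (hP := PI2_1).
(* The cap at 1 keeps pi/2 - e where tan is inverted by atan. *)
set (e := Rmin eps 1). assert (h1 := Rmin_l eps 1). assert (h2 := Rmin_r eps 1).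
assert (h3 : 0 < e) by (apply Rmin_pos; lra). fold e in h1, h2.
assert (hM : forall x, tan (PI / 2 - e) < x -> PI / 2 - e < atan x < PI / 2).
{ intros x Hx. split.
  - rewrite <- (atan_tan (PI / 2 - e)) by lra. apply atan_increasing, Hx.
  - apply atan_bound. }
split.
- exists (tan (PI / 2 - e)). intros x y Hx Hy. assert (h4 := hM x Hx). assert (h5 := hM y Hy).
  apply Rabs_def1; lra.
- exists (- tan (PI / 2 - e)). intros x y Hx Hy.
  assert (h4 := hM (- x) ltac:(lra)). assert (h5 := hM (- y) ltac:(lra)).
  rewrite atan_opp in h4, h5. apply Rabs_def1; lra.
Qed.

(** The increments of the primitive from 0 are controlled by those of atan, so it is Cauchy at both
    ends. The constant is the total variation pi of atan times 2 for the two components. *)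
Lemma exists_has_integral f B : contC f -> (forall t, (1 + t ^ 2) * Cmod (f t) <= B) ->
  exists l, has_integral f l /\ Cmod l <= 2 * PI * B.
Proof.
intros Hc HB.
assert (Hprim : forall u : R -> R, (forall t : R, continuous u t) ->
  forall t, is_derive (fun x => RInt u 0 x) t (u t)).
{ intros u Hu t. apply (is_derive_RInt (V := R_NormedModule) u _ 0).
  - apply filter_forall. intros x. apply (RInt_correct (V := R_CompleteNormedModule)).
    apply (ex_RInt_continuous (V := R_CompleteNormedModule)). intros; apply Hu.
  - apply Hu. }
set (G := fun t => (RInt (fun s => Re (f s)) 0 t, RInt (fun s => Im (f s)) 0 t) : C).
assert (HG : forall t, derC G t (f t)).
{ intros t. split; unfold G; simpl; apply Hprim; intros s; apply Hc. }
assert (HB0 : 0 <= B).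
{ eapply Rle_trans; [|apply (HB 0)]. assert (h := Cmod_ge_0 (f 0)). nra. }
assert (Hinc : forall x y, Cmod (G y - G x)%C <= 2 * B * Rabs (atan y - atan x)).
{ assert (P : forall x y, x <= y -> Cmod (G y - G x)%C <= 2 * B * Rabs (atan y - atan x)).
  { intros x y Hxy. eapply Rle_trans; [apply Cmod_le_Re_Im|].
    assert (h1 := atan_dominates (fun t => Re (G t)) (fun t => Re (f t)) B x y
      (fun t => proj1 (HG t))).
    assert (h2 := atan_dominates (fun t => Im (G t)) (fun t => Im (f t)) B x y
      (fun t => proj2 (HG t))).
    assert (hw : forall t, 0 <= 1 + t ^ 2) by (intros t; nra).
    specialize (h1 (fun t => Rle_trans _ _ _
      (Rmult_le_compat_l _ _ _ (hw t) (re_le_Cmod (f t))) (HB t)) Hxy).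
    specialize (h2 (fun t => Rle_trans _ _ _
      (Rmult_le_compat_l _ _ _ (hw t) (im_le_Cmod (f t))) (HB t)) Hxy).
    change (Re (G y - G x)%C) with (Re (G y) - Re (G x)).
    change (Im (G y - G x)%C) with (Im (G y) - Im (G x)).
    assert (h3 := Rle_abs (atan y - atan x)). nra. }
  intros x y. destruct (Rle_dec x y) as [Hxy|Hxy]; [auto|].
  rewrite <- Cmod_opp, <- Rabs_Ropp.
  replace (- (G y - G x))%C with (G x - G y)%C by ring.
  replace (- (atan y - atan x)) with (atan x - atan y) by ring. apply P. lra. }
assert (Hball : forall (eps : R) x y, 0 < eps -> Rabs (atan y - atan x) < eps / (2 * B + 1) ->
  Cmod (G y - G x)%C < eps).
{ intros eps x y He Hlt. eapply Rle_lt_trans; [apply Hinc|].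
  apply Rle_lt_trans with ((2 * B) * (eps / (2 * B + 1))).
  - apply Rmult_le_compat_l; lra.
  - apply Rmult_lt_reg_r with (2 * B + 1); [lra|]. field_simplify; [nra|lra]. }
assert (Hlim : forall F, ProperFilter F -> (forall eps, 0 < eps -> exists P : R -> Prop,
   F P /\ forall x y, P x -> P y -> Rabs (atan y - atan x) < eps) ->
   exists l : C, filterlim G F (locally l)).
{ intros F FF HF.
  apply (filterlim_locally_cauchy (U := C_CompleteNormedModule)).
  intros eps. destruct (HF (eps / (2 * B + 1))) as [P [HP1 HP2]].
  { apply Rdiv_lt_0_compat; [apply cond_pos|lra]. }
  exists P. split; auto. intros x y Hx Hy.
  apply (C_NormedModule_mixin_compat1 (G x) (G y) eps).
  apply Hball; [apply cond_pos|]. auto. }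
destruct (Hlim (Rbar_locally m_infty) _) as [la Hla].
{ intros eps He. destruct (proj2 (atan_cauchy eps He)) as [M HM].
  exists (fun x => x < M). split; [exists M; auto|auto]. }
destruct (Hlim (Rbar_locally p_infty) _) as [lb Hlb].
{ intros eps He. destruct (proj1 (atan_cauchy eps He)) as [M HM].
  exists (fun x => M < x). split; [exists M; auto|auto]. }
exists (lb - la)%C. split.
{ exists G, la, lb. auto. }
apply Rnot_lt_le. intros Hlt.
set (e := (Cmod (lb - la)%C - 2 * PI * B) / 2). assert (He : 0 < e) by (unfold e; lra).
destruct (proj1 (filterlim_C _ _ _) Hla e He) as [M1 HM1].
destruct (proj1 (filterlim_C _ _ _) Hlb e He) as [M2 HM2].
specialize (HM1 (M1 - 1) ltac:(lra)). specialize (HM2 (M2 + 1) ltac:(lra)).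
assert (h := Hinc (M1 - 1) (M2 + 1)).
assert (h' : Rabs (atan (M2 + 1) - atan (M1 - 1)) <= PI).
{ assert (b1 := atan_bound (M2 + 1)). assert (b2 := atan_bound (M1 - 1)).
  apply Rabs_le. lra. }
assert (E : (lb - la = - (G (M2 + 1)%R - lb) + (G (M1 - 1)%R - la)
  + (G (M2 + 1)%R - G (M1 - 1)%R))%C) by ring.
assert (t1 := Cmod_triangle (- (G (M2 + 1)%R - lb) + (G (M1 - 1)%R - la))
  (G (M2 + 1)%R - G (M1 - 1)%R)%C).
assert (t2 := Cmod_triangle (- (G (M2 + 1)%R - lb)) (G (M1 - 1)%R - la)).
rewrite <- E in t1. rewrite Cmod_opp in t2. unfold e in *. nra.
Qed.

Definition nice (f : R -> C) : Prop :=
  contC f /\ exists B, forall t, (1 + t ^ 2) * Cmod (f t) <= B.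

Lemma integral_correct f : nice f -> has_integral f (integral f).
Proof.
intros [Hc [B HB]]. destruct (exists_has_integral f B Hc HB) as [l [Hl _]].
rewrite (has_integral_integral f l Hc Hl). exact Hl.
Qed.

Lemma integral_bound f B : contC f -> (forall t, (1 + t ^ 2) * Cmod (f t) <= B) ->
  Cmod (integral f) <= 2 * PI * B.
Proof.
intros Hc HB. destruct (exists_has_integral f B Hc HB) as [l [Hl HlB]].
rewrite (has_integral_integral f l Hc Hl). exact HlB.
Qed.

Lemma filterlim_Cplus F {FF : Filter F} (f g : R -> C) (l m : C) :
  filterlim f F (locally l) -> filterlim g F (locally m) ->
  filterlim (fun t => f t + g t)%C F (locally (l + m)%C).
Proof.
rewrite !(filterlim_C F). intros Hf Hg eps He.
specialize (Hf (eps / 2) ltac:(lra)). specialize (Hg (eps / 2) ltac:(lra)).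
generalize (filter_and _ _ Hf Hg).
apply filter_imp. intros t [h1 h2].
replace (f t + g t - (l + m))%C with ((f t - l) + (g t - m))%C by ring.
eapply Rle_lt_trans; [apply Cmod_triangle|]. lra.
Qed.

Lemma filterlim_Cscal F {FF : Filter F} c (f : R -> C) (l : C) :
  filterlim f F (locally l) -> filterlim (fun t => c * f t)%C F (locally (c * l)%C).
Proof.
rewrite !(filterlim_C F). intros Hf eps He.
assert (h0 := Cmod_ge_0 c).
specialize (Hf (eps / (Cmod c + 1)) ltac:(apply Rdiv_lt_0_compat; lra)). revert Hf.
apply filter_imp. intros t h.
replace (c * f t - c * l)%C with (c * (f t - l))%C by ring. rewrite Cmod_mult.
apply Rle_lt_trans with (Cmod c * (eps / (Cmod c + 1))).
- apply Rmult_le_compat_l; lra.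
- apply Rmult_lt_reg_r with (Cmod c + 1); [lra|]. field_simplify; [nra|lra].
Qed.

Lemma has_integral_plus f g l m : has_integral f l -> has_integral g m ->
  has_integral (fun t => f t + g t)%C (l + m)%C.
Proof.
intros [F [la [lb [HF [Ha [Hb ->]]]]]] [G [ma [mb [HG [Ga [Gb ->]]]]]].
exists (fun t => F t + G t)%C, (la + ma)%C, (lb + mb)%C. split; [|split; [|split]].
- intros t. apply derC_plus; auto.
- apply filterlim_Cplus; auto. typeclasses eauto.
- apply filterlim_Cplus; auto. typeclasses eauto.
- ring.
Qed.

Lemma has_integral_scal c f l : has_integral f l -> has_integral (fun t => c * f t)%C (c * l)%C.
Proof.
intros [F [la [lb [HF [Ha [Hb ->]]]]]].
exists (fun t => c * F t)%C, (c * la)%C, (c * lb)%C. split; [|split; [|split]].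
- intros t. apply derC_scal; auto.
- apply filterlim_Cscal; auto. typeclasses eauto.
- apply filterlim_Cscal; auto. typeclasses eauto.
- ring.
Qed.

Lemma has_integral_dilate f l x0 eps : 0 < eps -> has_integral f l ->
  has_integral (fun t => RtoC (/ eps) * f ((t - x0) / eps)%R)%C l.
Proof.
intros He [F [la [lb [HF [Ha [Hb ->]]]]]].
exists (fun t => F ((t - x0) / eps)), la, lb. split; [|split; [|split]]; auto.
- intros t. apply (derC_comp F (fun t => (t - x0) / eps)); auto.
  auto_derive; [lra|field; lra].
- apply (filterlim_comp _ _ _ (fun t => (t - x0) / eps) F _ (Rbar_locally m_infty)); auto.
  intros P [M HM]. exists (eps * M + x0). intros t Ht. apply HM.
  apply Rmult_lt_reg_r with eps; auto. field_simplify; lra.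
- apply (filterlim_comp _ _ _ (fun t => (t - x0) / eps) F _ (Rbar_locally p_infty)); auto.
  intros P [M HM]. exists (eps * M + x0). intros t Ht. apply HM.
  apply Rmult_lt_reg_r with eps; auto. field_simplify; lra.
Qed.

Lemma nice_plus f g : nice f -> nice g -> nice (fun t => f t + g t)%C.
Proof.
intros [Hf [A HA]] [Hg [B HB]]. split; [apply contC_plus; auto|].
exists (A + B). intros t. specialize (HA t). specialize (HB t).
assert (h := Cmod_triangle (f t) (g t)). assert (0 <= 1 + t ^ 2) by nra. nra.
Qed.

Lemma nice_mult_bounded f g M : (forall t, Cmod (g t) <= M) -> contC g -> nice f ->
  nice (fun t => g t * f t)%C.
Proof.
intros HM Hg [Hf [A HA]]. split; [apply contC_mult; auto|].
exists (M * A). intros t. rewrite Cmod_mult. specialize (HA t). specialize (HM t).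
assert (h := Cmod_ge_0 (g t)). assert (h' := Cmod_ge_0 (f t)).
assert (0 <= 1 + t ^ 2) by nra.
replace ((1 + t ^ 2) * (Cmod (g t) * Cmod (f t))) with
  (Cmod (g t) * ((1 + t ^ 2) * Cmod (f t))) by ring.
apply Rmult_le_compat; auto. apply Rmult_le_pos; auto.
Qed.

Lemma nice_scal c f : nice f -> nice (fun t => c * f t)%C.
Proof.
apply (nice_mult_bounded f (fun _ => c) (Cmod c)); [|apply contC_const]. intros; lra.
Qed.

Lemma integral_plus f g : nice f -> nice g ->
  integral (fun t => f t + g t)%C = (integral f + integral g)%C.
Proof.
intros Hf Hg. apply has_integral_integral; [apply nice_plus; auto|].
apply has_integral_plus; apply integral_correct; auto.
Qed.

Lemma integral_scal c f : nice f -> integral (fun t => c * f t)%C = (c * integral f)%C.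
Proof.
intros Hf. apply has_integral_integral; [apply nice_scal; auto|].
apply has_integral_scal; apply integral_correct; auto.
Qed.

Lemma integral_ext f g : (forall t, f t = g t) -> integral f = integral g.
Proof. intros H. f_equal. apply functional_extensionality, H. Qed.

(** [f] is its own primitive for the integral, and the bound on t f(t) makes it vanish at both
    ends. *)
Lemma integral_derivative f f' : (forall t, derC f t (f' t)) -> contC f' ->
  (exists B, forall t, Rabs t * Cmod (f t) <= B) -> integral f' = 0%C.
Proof.
intros Hd Hc [B HB]. apply has_integral_integral; auto.
assert (HB0 : 0 <= B).
{ eapply Rle_trans; [|apply (HB 0)]. rewrite Rabs_R0. lra. }
assert (P : forall eps t, 0 < eps -> B / eps + 1 < Rabs t -> Cmod (f t - 0)%C < eps).
{ intros eps t He Ht. replace (f t - 0)%C with (f t) by ring.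
  specialize (HB t). assert (h := Cmod_ge_0 (f t)).
  assert (h1 : 0 <= B / eps) by (apply Rdiv_le_0_compat; auto).
  apply Rmult_lt_reg_l with (Rabs t); [lra|]. eapply Rle_lt_trans; [exact HB|].
  replace B with ((B / eps) * eps) by (field; lra). apply Rmult_lt_compat_r; lra. }
exists f, (RtoC 0), (RtoC 0). split; [exact Hd|split; [|split]].
- apply (filterlim_C (Rbar_locally m_infty)). intros eps He. exists (- (B / eps + 1)). intros t Ht.
  apply P; auto. assert (h := Rle_abs (- t)). rewrite Rabs_Ropp in h. lra.
- apply (filterlim_C (Rbar_locally p_infty)). intros eps He. exists (B / eps + 1). intros t Ht.
  apply P; auto. assert (h := Rle_abs t). lra.
- ring.
Qed.

(** * Fourier transforms and the asymptotic expansion *)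

Definition rapid (f : R -> C) : Prop :=
  forall j : nat, exists B, forall t, Rabs t ^ j * Cmod (f t) <= B.

(** Schwartz conditions on [N] derivatives, given existentially, so that sums and products by t are
    handled by induction without formulas for iterated derivatives. *)
Fixpoint Sch (N : nat) (f : R -> C) : Prop :=
  rapid f /\ contC f /\
  match N with
  | O => True
  | S M => exists f', (forall t, derC f t (f' t)) /\ Sch M f'
  end.

Lemma Sch_rapid N f : Sch N f -> rapid f.
Proof. destruct N; intros [H _]; exact H. Qed.

Lemma Sch_cont N f : Sch N f -> contC f.
Proof. destruct N; intros [_ [H _]]; exact H. Qed.

Lemma Sch_pred N f : Sch (S N) f -> Sch N f.
Proof.
revert f. induction N as [|N IH]; intros f [H1 [H2 [f' [H3 H4]]]];
  (split; [exact H1|split; [exact H2|]]); auto.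
exists f'. auto.
Qed.

Lemma rapid_nice f : rapid f -> contC f -> nice f.
Proof.
intros H Hc. split; auto. destruct (H 0%nat) as [A HA]. destruct (H 2%nat) as [B HB].
exists (A + B). intros t. specialize (HA t). specialize (HB t).
rewrite RPow_abs, Rabs_pos_eq in HB by nra. simpl in *. lra.
Qed.

Lemma Sch_nice N f : Sch N f -> nice f.
Proof. intros H. apply rapid_nice; [eapply Sch_rapid|eapply Sch_cont]; eassumption. Qed.

Lemma rapid_plus f g : rapid f -> rapid g -> rapid (fun t => f t + g t)%C.
Proof.
intros Hf Hg j. destruct (Hf j) as [A HA]. destruct (Hg j) as [B HB].
exists (A + B). intros t. specialize (HA t). specialize (HB t).
assert (h := Cmod_triangle (f t) (g t)).
assert (h' : 0 <= Rabs t ^ j) by apply pow_le, Rabs_pos. nra.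
Qed.

Lemma rapid_mult_t c f : rapid f -> rapid (fun t => c * RtoC t * f t)%C.
Proof.
intros Hf j. destruct (Hf (S j)) as [B HB]. exists (Cmod c * B). intros t.
specialize (HB t). rewrite !Cmod_mult, Cmod_R. simpl in HB.
replace (Rabs t ^ j * (Cmod c * Rabs t * Cmod (f t))) with
  (Cmod c * (Rabs t * Rabs t ^ j * Cmod (f t))) by ring.
apply Rmult_le_compat_l; auto. apply Cmod_ge_0.
Qed.

Lemma rapid_scal c f : rapid f -> rapid (fun t => c * f t)%C.
Proof.
intros Hf j. destruct (Hf j) as [B HB]. exists (Cmod c * B). intros t.
specialize (HB t). rewrite Cmod_mult.
replace (Rabs t ^ j * (Cmod c * Cmod (f t))) with
  (Cmod c * (Rabs t ^ j * Cmod (f t))) by ring.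
apply Rmult_le_compat_l; auto. apply Cmod_ge_0.
Qed.

Lemma Sch_plus N : forall f g, Sch N f -> Sch N g -> Sch N (fun t => f t + g t)%C.
Proof.
induction N as [|N IH]; intros f g [F1 [F2 F3]] [G1 [G2 G3]];
  (split; [apply rapid_plus; auto|split; [apply contC_plus; auto|]]); auto.
destruct F3 as [f' [F3 F4]], G3 as [g' [G3 G4]].
exists (fun t => f' t + g' t)%C. split; auto. intros t. apply derC_plus; auto.
Qed.

Lemma Sch_scal N c : forall f, Sch N f -> Sch N (fun t => c * f t)%C.
Proof.
induction N as [|N IH]; intros f [F1 [F2 F3]];
  (split; [apply rapid_scal; auto|split; [apply contC_mult; auto; apply contC_const|]]); auto.
destruct F3 as [f' [F3 F4]].
exists (fun t => c * f' t)%C. split; auto. intros t. apply derC_scal; auto.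
Qed.

Lemma derC_linear c x : derC (fun t => c * RtoC t)%C x c.
Proof.
eapply derC_eq; [|apply derC_scal, derC_RtoC, @is_derive_id]. apply Cmult_1_r.
Qed.

Lemma Sch_mult_t N c : forall f, Sch N f -> Sch N (fun t => c * RtoC t * f t)%C.
Proof.
assert (Hc : contC (fun t => c * RtoC t)%C) by (apply (contC_derC _ (fun _ => c)), derC_linear).
induction N as [|N IH]; intros f Hf; assert (Hf0 := Hf); destruct Hf as [F1 [F2 F3]];
  (split; [apply rapid_mult_t; auto|split; [apply (contC_mult _ _ Hc); auto|]]); auto.
destruct F3 as [f' [F3 F4]].
exists (fun t => c * f t + c * RtoC t * f' t)%C. split.
- intros t. apply (derC_mult (fun t => c * RtoC t)%C); [apply derC_linear|auto].
- apply Sch_plus; [apply Sch_scal, Sch_pred, Hf0|apply IH, F4].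
Qed.

(** Normalised so that pairing exp (i pi n^2 t) with a test function gives its transform at n^2. *)
Definition fourier (f : R -> C) (xi : R) : C :=
  integral (fun t => cis (PI * xi * t) * f t)%C.

Lemma derC_cis a t : derC (fun t => cis (a * t)) t (Ci * RtoC a * cis (a * t))%C.
Proof. split; simpl; unfold Re, Im; auto_derive; auto; simpl; ring. Qed.

Lemma contC_cis a : contC (fun t => cis (a * t)).
Proof. exact (contC_derC _ (fun t => (Ci * RtoC a * cis (a * t))%C) (derC_cis a)). Qed.

Lemma nice_cis a f : nice f -> nice (fun t => cis (a * t) * f t)%C.
Proof.
apply (nice_mult_bounded f _ 1); [|apply contC_cis]. intros t. rewrite Cmod_cis. lra.
Qed.

Lemma fourier_bound f xi B : contC f -> (forall t, (1 + t ^ 2) * Cmod (f t) <= B) ->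
  Cmod (fourier f xi) <= 2 * PI * B.
Proof.
intros Hc HB. apply integral_bound; [apply contC_mult; auto; apply contC_cis|].
intros t. rewrite Cmod_mult, Cmod_cis, Rmult_1_l. apply HB.
Qed.

Lemma fourier_derivative f f' xi : (forall t, derC f t (f' t)) -> rapid f -> nice f' ->
  fourier f' xi = (- (Ci * RtoC (PI * xi)) * fourier f xi)%C.
Proof.
intros Hd Hr Hf'. assert (Hc := contC_derC _ _ Hd). assert (Hf := rapid_nice f Hr Hc).
assert (H : integral (fun t => cis (PI * xi * t) * f' t +
  (Ci * RtoC (PI * xi)) * (cis (PI * xi * t) * f t))%C = 0%C).
{ apply (integral_derivative (fun t => cis (PI * xi * t) * f t)%C).
  - intros t. eapply derC_eq; [|apply derC_mult; [apply derC_cis|apply Hd]]. cbv beta. ring.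
  - apply (nice_plus (fun t => cis (PI * xi * t) * f' t)%C); [|apply nice_scal];
    apply nice_cis; auto.
  - destruct (Hr 1%nat) as [B HB]. exists B. intros t. specialize (HB t).
    rewrite Cmod_mult, Cmod_cis, Rmult_1_l. rewrite pow_1 in HB. exact HB. }
rewrite integral_plus in H; [|apply nice_cis; auto|apply nice_scal, nice_cis; auto].
rewrite integral_scal in H by (apply nice_cis; auto).
unfold fourier.
rewrite <- (Cplus_0_r (integral (fun t => cis (PI * xi * t) * f' t)%C)).
rewrite <- (Cplus_opp_r (Ci * RtoC (PI * xi) * integral (fun t => cis (PI * xi * t) * f t))%C).
rewrite Cplus_assoc, H. ring.
Qed.

Lemma PI_ge_1 : 1 <= PI.
Proof. assert (h := PI2_1). lra. Qed.

(** Each derivative of [f] contributes a factor of modulus pi |xi| >= |xi|. *)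
Lemma fourier_decay j : forall f, Sch j f ->
  exists K, forall xi, Rabs xi ^ j * Cmod (fourier f xi) <= K.
Proof.
induction j as [|j IH]; intros f Hf.
- destruct (Sch_nice _ _ Hf) as [Hc [B HB]]. exists (2 * PI * B). intros xi.
  simpl. rewrite Rmult_1_l. apply fourier_bound; auto.
- assert (Hr := Sch_rapid _ _ Hf). destruct Hf as [_ [_ [f' [Hd Hf']]]].
  destruct (IH f' Hf') as [K HK]. exists K. intros xi. specialize (HK xi).
  rewrite (fourier_derivative f f' xi Hd Hr (Sch_nice _ _ Hf')) in HK.
  rewrite Cmod_mult, Cmod_opp, Cmod_mult, Cmod_Ci, Cmod_R, Rabs_mult in HK.
  rewrite (Rabs_pos_eq PI), Rmult_1_l in HK by (assert (h := PI_ge_1); lra).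
  eapply Rle_trans; [|exact HK].
  replace (Rabs xi ^ j * (PI * Rabs xi * Cmod (fourier f xi))) with
    (PI * (Rabs xi ^ S j * Cmod (fourier f xi))) by (simpl; ring).
  rewrite <- (Rmult_1_l (Rabs xi ^ S j * Cmod (fourier f xi))) at 1.
  apply Rmult_le_compat_r; [|apply PI_ge_1].
  apply Rmult_le_pos; [apply pow_le, Rabs_pos|apply Cmod_ge_0].
Qed.

(** Two applications of the mean value inequality, each with its factor 2; conjugation handles
    negative [u]. *)
Lemma cis_taylor u : Cmod (cis u - 1 - Ci * RtoC u)%C <= 4 * u ^ 2.
Proof.
assert (H1 : forall v, 0 <= v -> Cmod (cis v - 1)%C <= 2 * v).
{ intros v Hv.
  assert (h := mean_value_ineq (fun t => cis (1 * t)) (fun t => Ci * RtoC 1 * cis (1 * t))%C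
    0 v 1 Hv (fun t _ => derC_cis 1 t)).
  cbv beta in h.
  replace (cis (1 * 0)) with (RtoC 1) in h
    by (rewrite Rmult_0_r; unfold cis; rewrite cos_0, sin_0; reflexivity).
  rewrite (Rmult_1_l v) in h. eapply Rle_trans; [apply h|lra].
  intros t _. rewrite !Cmod_mult, Cmod_cis, Cmod_Ci, Cmod_R, Rabs_R1. lra. }
assert (H2 : forall v, 0 <= v -> Cmod (cis v - 1 - Ci * RtoC v)%C <= 4 * v ^ 2).
{ intros v Hv.
  assert (h := mean_value_ineq (fun t => cis (1 * t) - 1 - Ci * RtoC t)%C
    (fun t => Ci * RtoC 1 * cis (1 * t) - 0 - Ci)%C 0 v (2 * v) Hv).
  cbv beta in h.
  rewrite (Rmult_1_l v) in h.
  replace (cis v - 1 - Ci * RtoC v - (cis (1 * 0) - 1 - Ci * 0))%C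
    with (cis v - 1 - Ci * RtoC v)%C in h.
  - eapply Rle_trans; [apply h|].
    + intros t _. apply derC_minus; [apply derC_minus;
      [apply derC_cis|apply derC_const]|apply derC_linear].
    + intros t Ht. replace (Ci * 1 * cis (1 * t) - 0 - Ci)%C
        with (Ci * (cis t - 1))%C by (rewrite Rmult_1_l; ring).
      rewrite Cmod_mult, Cmod_Ci, Rmult_1_l. eapply Rle_trans; [apply H1|]; lra.
    + right. ring.
  - rewrite Rmult_0_r. unfold cis at 3. rewrite cos_0, sin_0.
    change (1, 0) with (RtoC 1). ring. }
destruct (Rle_dec 0 u) as [Hu|Hu]; [apply H2, Hu|].
replace (u ^ 2) with ((- u) ^ 2) by ring. rewrite <- Cmod_conj.
replace (Cconj (cis u - 1 - Ci * RtoC u))%C with (cis (- u) - 1 - Ci * RtoC (- u))%C.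
- apply H2. lra.
- unfold cis. rewrite cos_neg, sin_neg. apply injective_projections; simpl; ring.
Qed.

Lemma derC_of_quadratic (f : R -> C) x l K :
  (forall h, Cmod (f (x + h)%R - f x - RtoC h * l)%C <= K * h ^ 2) -> derC f x l.
Proof.
intros H.
assert (P : forall (u : R -> R) a, (forall h, Rabs (u (x + h) - u x - h * a) <= K * h ^ 2) ->
  is_derive u x a).
{ intros u a Hu. apply is_derive_Reals. intros eps He.
  assert (HK : 0 <= K).
  { specialize (Hu 1). assert (h := Rabs_pos (u (x + 1) - u x - 1 * a)). lra. }
  exists (mkposreal (eps / (K + 1)) ltac:(apply Rdiv_lt_0_compat; lra)).
  intros h Hh Hlt. simpl in Hlt. specialize (Hu h).
  replace ((u (x + h) - u x) / h - a) with ((u (x + h) - u x - h * a) / h)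
    by (field; auto).
  assert (h0 : 0 < Rabs h) by (apply Rabs_pos_lt; auto).
  unfold Rdiv. rewrite Rabs_mult, Rabs_inv.
  apply Rmult_lt_reg_r with (Rabs h); auto. rewrite Rmult_assoc, Rinv_l, Rmult_1_r by lra.
  eapply Rle_lt_trans; [exact Hu|].
  replace (h ^ 2) with (Rabs h * Rabs h) by (rewrite <- Rabs_mult, Rabs_pos_eq; nra).
  rewrite <- Rmult_assoc. apply Rmult_lt_compat_r; auto.
  apply Rle_lt_trans with (K * (eps / (K + 1))).
  - apply Rmult_le_compat_l; lra.
  - apply Rmult_lt_reg_r with (K + 1); [lra|]. field_simplify; [nra|lra]. }
split; apply P; intros h; (eapply Rle_trans; [|apply (H h)]).
- eapply Rle_trans; [|apply re_le_Cmod]. right. f_equal.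
  simpl. unfold Re. ring.
- eapply Rle_trans; [|apply im_le_Cmod]. right. f_equal.
  simpl. unfold Im. ring.
Qed.

Definition mult_ipit (f : R -> C) (t : R) : C := (Ci * RtoC PI * RtoC t * f t)%C.

Lemma nice_lincomb c d f g h : nice f -> nice g -> nice h ->
  nice (fun t => f t + c * g t + d * h t)%C.
Proof.
intros Hf Hg Hh. apply (nice_plus (fun t => f t + c * g t)%C); [|apply nice_scal, Hh].
apply (nice_plus f); [exact Hf|apply nice_scal, Hg].
Qed.

Lemma integral_lincomb c d f g h : nice f -> nice g -> nice h ->
  integral (fun t => f t + c * g t + d * h t)%C
    = (integral f + c * integral g + d * integral h)%C.
Proof.
intros Hf Hg Hh.
assert (Hg' := nice_scal c g Hg). assert (Hh' := nice_scal d h Hh).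
assert (Hfg := nice_plus _ _ Hf Hg').
rewrite (integral_plus _ _ Hfg Hh'), (integral_plus _ _ Hf Hg'), !integral_scal by assumption.
reflexivity.
Qed.

(** Differentiation under the integral sign: the integrand of the remainder is at most 4 (pi h t)^2
    |f(t)|, and (pi t)^2 f(t) is still integrable since [f] decays rapidly. *)
Lemma derC_fourier f xi : Sch 0 f -> derC (fourier f) xi (fourier (mult_ipit f) xi).
Proof.
intros Hf.
assert (Hf1 : Sch 0 (mult_ipit f)) by (apply Sch_mult_t, Hf).
assert (Hf2 : Sch 0 (mult_ipit (mult_ipit f))) by (apply Sch_mult_t, Hf1).
destruct (Sch_nice _ _ Hf2) as [_ [B HB]].
assert (N0 := Sch_nice _ _ Hf). assert (N1 := Sch_nice _ _ Hf1).
apply derC_of_quadratic with (2 * PI * (4 * B)). intros h.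
assert (C1 := nice_cis (PI * (xi + h)) f N0). assert (C2 := nice_cis (PI * xi) f N0).
assert (C3 := nice_cis (PI * xi) (mult_ipit f) N1).
assert (E : (fourier f (xi + h) - fourier f xi - RtoC h * fourier (mult_ipit f) xi)%C =
  integral (fun t => cis (PI * (xi + h) * t) * f t + - (1) * (cis (PI * xi * t) * f t)
    + - RtoC h * (cis (PI * xi * t) * mult_ipit f t))%C).
{ rewrite (integral_lincomb (- (1)) (- RtoC h) _ _ _ C1 C2 C3). unfold fourier. ring. }
rewrite E. replace (2 * PI * (4 * B) * h ^ 2) with (2 * PI * (h ^ 2 * 4 * B)) by ring.
apply integral_bound.
- exact (proj1 (nice_lincomb (- (1)) (- RtoC h) _ _ _ C1 C2 C3)).
- intros t.
  replace (cis (PI * (xi + h) * t) * f t + - (1) * (cis (PI * xi * t) * f t)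
    + - RtoC h * (cis (PI * xi * t) * mult_ipit f t))%C with
    (cis (PI * xi * t) * ((cis (PI * h * t) - 1 - Ci * RtoC (PI * h * t)) * f t))%C.
  2: { replace (PI * (xi + h) * t) with (PI * xi * t + PI * h * t) by ring.
       rewrite cis_plus. unfold mult_ipit. rewrite !RtoC_mult. ring. }
  rewrite !Cmod_mult, Cmod_cis, Rmult_1_l.
  assert (h1 := cis_taylor (PI * h * t)). specialize (HB t).
  unfold mult_ipit in HB. rewrite !Cmod_mult, Cmod_Ci, !Cmod_R in HB.
  replace ((1 + t ^ 2) * (1 * Rabs PI * Rabs t * (1 * Rabs PI * Rabs t * Cmod (f t))))
    with ((PI * t) ^ 2 * ((1 + t ^ 2) * Cmod (f t))) in HB.
  + assert (h2 : 0 <= (1 + t ^ 2) * Cmod (f t)).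
    { apply Rmult_le_pos; [nra|apply Cmod_ge_0]. }
    apply Rle_trans with (4 * (PI * h * t) ^ 2 * ((1 + t ^ 2) * Cmod (f t))).
    * rewrite <- Rmult_assoc, (Rmult_comm (1 + t ^ 2)), Rmult_assoc.
      apply Rmult_le_compat_r; auto.
    * replace (4 * (PI * h * t) ^ 2 * ((1 + t ^ 2) * Cmod (f t))) with
        (h ^ 2 * 4 * ((PI * t) ^ 2 * ((1 + t ^ 2) * Cmod (f t)))) by ring.
      apply Rmult_le_compat_l; auto. nra.
  + replace ((PI * t) ^ 2) with (Rabs (PI * t) * Rabs (PI * t))
      by (rewrite <- Rabs_mult, Rabs_pos_eq; nra).
    rewrite Rabs_mult. ring.
Qed.

Fixpoint mult_ipit_n (k : nat) (f : R -> C) : R -> C :=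
  match k with O => f | S k => mult_ipit (mult_ipit_n k f) end.

Lemma Sch_mult_ipit_n N k f : Sch N f -> Sch N (mult_ipit_n k f).
Proof. intros H. induction k as [|k IH]; auto. apply Sch_mult_t, IH. Qed.

(** * Taylor remainders at the origin and their dilates *)

Definition rapid_family (F : nat -> R -> C) : Prop :=
  (forall k x, derC (F k) x (F (S k) x)) /\
  forall j k, exists K, forall x, Rabs x ^ j * Cmod (F k x) <= K.

Lemma fourier_family f : (forall N, Sch N f) ->
  rapid_family (fun k => fourier (mult_ipit_n k f)).
Proof.
intros H. split.
- intros k x. apply derC_fourier, Sch_mult_ipit_n, H.
- intros j k. apply fourier_decay, Sch_mult_ipit_n, H.
Qed.

(** There are [m] terms, so the degree is below [m] and the remainder is of order x^m. *)
Definition tay (m : nat) (c : nat -> C) (x : R) : C :=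
  psum (fun i => c i * RtoC (x ^ i / INR (fact i)))%C m.

Lemma derC_tay m c x : derC (tay (S m) c) x (tay m (fun i => c (S i)) x).
Proof.
induction m as [|m IH].
- apply derC_ext_loc with (fun _ => c 0%nat); [|apply derC_const].
  apply filter_forall. intros y. unfold tay. simpl. replace (1 / 1) with 1 by field. ring.
- apply (derC_plus (tay (S m) c) (fun x => c (S m) * RtoC (x ^ S m / INR (fact (S m))))%C);
    [exact IH|].
  apply derC_scal, derC_RtoC.
  assert (h := INR_fact_neq_0 m). assert (h' : INR (S m) <> 0) by (apply not_0_INR; lia).
  assert (E : is_derive (fun y => / INR (fact (S m)) * y ^ S m) x
     (/ INR (fact (S m)) * (INR (S m) * 1 * x ^ m))).
  { apply is_derive_scal. apply (is_derive_pow (fun y => y)), @is_derive_id. }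
  apply (is_derive_ext (fun y => / INR (fact (S m)) * y ^ S m));
    [intros y; apply Rmult_comm|].
  refine (is_derive_eq _ _ _ _ _ E).
  change (fact (S m)) with (S m * fact m)%nat. rewrite mult_INR. field. auto.
Qed.

Lemma tay_0 m c : tay (S m) c 0 = c 0%nat.
Proof.
induction m as [|m IH].
- unfold tay. simpl. replace (1 / 1) with 1 by field. ring.
- change (tay (S (S m)) c 0) with (tay (S m) c 0 + c (S m) * RtoC (0 ^ S m / INR (fact (S m))))%C.
  rewrite IH. simpl pow. rewrite Rmult_0_l. unfold Rdiv. rewrite Rmult_0_l. ring.
Qed.

(* The Taylor remainder of order [m], with all its derivatives, vanishes like [x^m] at [0] in
   the scale-invariant sense, and the rapid decay of [F] keeps these bounds true at infinity. *)
Lemma taylor_family m : forall F, rapid_family F ->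
  exists Psi : nat -> R -> C,
    (forall x, Psi 0%nat x = F 0%nat x - tay m (fun i => F i 0%R) x)%C /\
    (forall k x, derC (Psi k) x (Psi (S k) x)) /\
    forall i, exists K, forall x, 0 <= x -> x ^ i * Cmod (Psi i x) <= K * x ^ m.
Proof.
induction m as [|m IH]; intros F [HF1 HF2].
- exists F. split; [|split]; auto.
  + intros x. unfold tay. simpl. ring.
  + intros i. destruct (HF2 i i) as [K HK]. exists K. intros x Hx.
    specialize (HK x). rewrite Rabs_pos_eq in HK by auto. simpl. lra.
- destruct (IH (fun k => F (S k))) as [P [P0 [P1 P2]]].
  { split; auto. }
  (* The derivative of the remainder of order m + 1 is the remainder of order m of the derivatives,
     so one function is put in front of the sequence. It vanishes at 0, and integration from 0 gains
     the factor x. *)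
  set (Psi := fun k => match k with
    | O => fun x => (F 0%nat x - tay (S m) (fun i => F i 0%R) x)%C
    | S k => P k end).
  assert (Hd : forall k x, derC (Psi k) x (Psi (S k) x)).
  { intros [|k] x; simpl; auto. rewrite P0. apply derC_minus; auto.
    apply (derC_tay m (fun i => F i 0)). }
  exists Psi. split; [|split]; auto.
  intros [|i].
  + destruct (P2 0%nat) as [K HK]. exists (2 * K). intros x Hx.
    assert (h := mean_value_ineq (Psi 0%nat) (Psi 1%nat) 0 x (K * x ^ m) Hx
      (fun t _ => Hd 0%nat t)).
    assert (HK0 : 0 <= K).
    { specialize (HK 1 ltac:(lra)). rewrite !pow1 in HK.
      assert (h1 := Cmod_ge_0 (P 0%nat 1)). simpl in HK. lra. }
    assert (E0 : Psi 0%nat 0 = 0%C).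
    { simpl. rewrite tay_0. ring. }
    rewrite E0 in h. replace (Psi 0%nat x - 0)%C with (Psi 0%nat x) in h by ring.
    rewrite pow_O, Rmult_1_l. eapply Rle_trans; [apply h|].
    * intros t Ht. specialize (HK t ltac:(lra)). rewrite pow_O, Rmult_1_l in HK.
      eapply Rle_trans; [exact HK|]. apply Rmult_le_compat_l; auto.
      apply pow_incr. lra.
    * right. simpl. ring.
  + destruct (P2 i) as [K HK]. exists K. intros x Hx. specialize (HK x Hx).
    simpl. replace (x * x ^ i * Cmod (P i x)) with (x * (x ^ i * Cmod (P i x))) by ring.
    replace (K * (x * x ^ m)) with (x * (K * x ^ m)) by ring.
    apply Rmult_le_compat_l; auto.
Qed.

(** With u = eps x^2, the x-derivative of u^i Psi_i(u) is (2/x) (i u^i Psi_i(u) + u^(i+1)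
    Psi_(i+1)(u)). The family is thus closed under differentiation up to a factor 1/x, and eps
    enters only through u^m = eps^m x^(2m). *)
Lemma symb_dilated m (Psi : nat -> R -> C)
  (Psi_derC : forall k x, derC (Psi k) x (Psi (S k) x))
  (Psi_bound : forall i, exists K, forall x, 0 <= x -> x ^ i * Cmod (Psi i x) <= K * x ^ m) N :
  forall i, exists B, forall eps, 0 < eps ->
  symb N (INR (2 * m)) (B * eps ^ m) (fun x => RtoC ((eps * x ^ 2) ^ i) * Psi i (eps * x ^ 2)%R)%C.
Proof.
assert (P : forall i, exists K, 0 <= K /\ forall B eps, K <= B -> 0 < eps -> forall x, 1 <= x ->
  Cmod (RtoC ((eps * x ^ 2) ^ i) * Psi i (eps * x ^ 2)%R)%C
    <= B * eps ^ m * Rpower x (INR (2 * m))).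
{ intros i. destruct (Psi_bound i) as [K HK]. exists K. split.
  { specialize (HK 1 ltac:(lra)). rewrite !pow1 in HK.
    assert (h1 := Cmod_ge_0 (Psi i 1)). lra. }
  intros B eps HB He x Hx.
  assert (hx : 0 <= eps * x ^ 2) by (apply Rmult_le_pos; nra).
  rewrite Cmod_mult, Cmod_R, Rabs_pos_eq by (apply pow_le, hx).
  eapply Rle_trans; [apply HK, hx|].
  rewrite Rpower_pow by lra. rewrite pow_mult, Rmult_assoc, <- Rpow_mult_distr.
  apply Rmult_le_compat_r; auto. apply pow_le, hx. }
induction N as [|N IH]; intros i; destruct (P i) as [K [HK HP]].
- exists K. intros eps He. split; [|exact I]. apply HP; lra.
- destruct (IH i) as [B1 H1]. destruct (IH (S i)) as [B2 H2].
  destruct (symb_Cpower1 N (- (1))) as [D [HD Hm1]].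
  assert (Hm1' : symb N (-1) D (fun x => Cpower x (- (1)))).
  { apply (symb_le N (Re (- (1))%C) D); [simpl; lra|lra|exact Hm1]. }
  set (E := 2 * (2 ^ N * (D * (INR i * B1 + B2)))).
  assert (HB1 : 0 <= B1).
  { assert (h := symb_pos _ _ _ _ (H1 1 Rlt_0_1)). rewrite pow1 in h. lra. }
  assert (HB2 : 0 <= B2).
  { assert (h := symb_pos _ _ _ _ (H2 1 Rlt_0_1)). rewrite pow1 in h. lra. }
  assert (HE : 0 <= E).
  { unfold E. assert (h := pos_INR i). assert (0 <= 2 ^ N) by (apply pow_le; lra).
    apply Rmult_le_pos; [lra|]. apply Rmult_le_pos; [lra|]. apply Rmult_le_pos; [lra|].
    nra. }
  exists (K + E). intros eps He. split; [apply HP; lra|].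
  exists (fun x => RtoC 2 * (Cpower x (- (1)) *
    (RtoC (INR i) * (RtoC ((eps * x ^ 2) ^ i) * Psi i (eps * x ^ 2)%R)
     + RtoC ((eps * x ^ 2) ^ S i) * Psi (S i) (eps * x ^ 2)%R)))%C.
  assert (hem : 0 < eps ^ m) by (apply pow_lt, He).
  split.
  + intros x Hx.
    assert (Du : is_derive (fun y => eps * y ^ 2) x (2 * eps * x)).
    { auto_derive; auto. ring. }
    eapply derC_eq; [|apply (derC_mult (fun y => RtoC ((eps * y ^ 2) ^ i))
      (fun y => Psi i (eps * y ^ 2)));
      [apply derC_RtoC, (is_derive_pow (fun y => eps * y ^ 2)), Du
      |apply (derC_comp (Psi i) (fun y => eps * y ^ 2)); [apply Psi_derC|apply Du]]].
    rewrite Cpower_m1 by lra.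
    destruct i as [|i].
    * rewrite Rmult_0_l, Rmult_0_l. simpl pow. rewrite Cmult_0_l.
      replace (2 * eps * x) with (2 * (/ x * (eps * (x * (x * 1)) * 1))) by (field; lra).
      rewrite !RtoC_mult. simpl INR. ring.
    * simpl Init.Nat.pred. set (v := eps * x ^ 2).
      replace (2 * eps * x) with (2 * (/ x * v)) by (unfold v; field; lra).
      simpl pow. rewrite !RtoC_mult. ring.
  + apply symb_le with (-1 + INR (2 * m)) (E * eps ^ m); [lra|nra|].
    replace (E * eps ^ m) with (Cmod (RtoC 2) * (2 ^ N * (D *
      (Cmod (RtoC (INR i)) * (B1 * eps ^ m) + B2 * eps ^ m)))).
    * apply symb_scal, symb_mult; auto. apply symb_plus; auto. apply symb_scal; auto.
    * rewrite !Cmod_R, (Rabs_pos_eq 2), (Rabs_pos_eq (INR i)) by (try lra; apply pos_INR).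
      unfold E. ring.
Qed.

(** The power (eps x^2)^i shifts the exponent b to b - 2i, so each Taylor term sums to a value of
    zeta. The bound on [N] makes one depth sufficient for all of them. *)
Lemma reg_tay q a b eps m N c : antiperiodic q a ->
  - Re b + 2 * INR m + 2 <= INR N ->
  reg q N (smp a (fun x => Cpower x (- b) * tay m c (eps * x ^ 2)%R)%C)
    (psum (fun i => c i * RtoC (eps ^ i / INR (fact i)) * zeta q a (b - 2 * RtoC (INR i)))%C m).
Proof.
intros Ha. induction m as [|m IH]; intros HN.
- simpl. replace (RtoC 0) with (RtoC 0 * zeta q a b)%C by ring.
  eapply reg_ext; [|apply reg_scal, (zeta_reg q a b N Ha); simpl in HN; lra].
  intros n. unfold smp, tay. simpl. ring.
- rewrite S_INR in HN. cbn [psum].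
  eapply reg_ext; [|apply reg_plus; [apply IH; lra|apply reg_scal, zeta_reg; [exact Ha|]]].
  + intros n. unfold dirichlet, smp, tay. cbn [psum].
    assert (E : RtoC ((eps * INR (S n) ^ 2) ^ m / INR (fact m)) =
      (RtoC (eps ^ m / INR (fact m)) * Cpower (INR (S n)) (2 * RtoC (INR m)))%C).
    { rewrite <- RtoC_mult, Cpower_RtoC, <- RtoC_mult. f_equal.
      replace (2 * INR m) with (INR (2 * m)) by (rewrite mult_INR; reflexivity).
      rewrite Rpower_pow by (assert (h := INR_S_ge_1 n); lra).
      rewrite pow_mult, Rpow_mult_distr. unfold Rdiv. ring. }
    rewrite E. replace (- (b - 2 * RtoC (INR m)))%C with (- b + 2 * RtoC (INR m))%C by ring.
    rewrite Cpower_plus. ring.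
  + replace (Re (b - 2 * RtoC (INR m))%C) with (Re b - 2 * INR m)
      by (simpl; unfold Re; simpl; ring). lra.
Qed.

(** Uniqueness at a common depth identifies the difference with the regularised sum of the Taylor
    remainder, although the separate Taylor terms may give divergent series. *)
Lemma expansion q a b m F : antiperiodic q a -> rapid_family F -> exists K,
  forall eps s, 0 < eps -> csum (smp a (fun x => Cpower x (- b) * F 0%nat (eps * x ^ 2)%R)%C) s ->
  Cmod (s - psum (fun i => F i 0%R * RtoC (eps ^ i / INR (fact i)) *
    zeta q a (b - 2 * RtoC (INR i))) m)%C <= K * eps ^ m.
Proof.
intros Ha HF. destruct (taylor_family m F HF) as [P [P0 [P1 P2]]].
destruct (exists_nat_ge (- Re b + 2 * INR m + 2)) as [N HN].
destruct (symb_dilated m P P1 P2 N 0) as [B HB].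
destruct (symb_Cpower1 N (- b)) as [D [HD Hb]].
destruct (reg_symb q N (Re (- b)%C + INR (2 * m))) as [K [HK HR]].
{ rewrite mult_INR. change (INR 2) with 2. change (Re (- b)%C) with (- Re b). lra. }
exists (K * (2 ^ N * (D * B))). intros eps s He Hs.
destruct (HR a _ _ Ha (symb_mult _ _ _ _ _ _ _ Hb (HB eps He))) as [t [Ht Ht']].
match goal with |- Cmod ?u <= _ => replace u with t end.
- eapply Rle_trans; [exact Ht'|]. right. ring.
- apply (reg_unique q N _ _ _ Ht).
  match goal with |- reg _ _ _ (?u - ?v)%C =>
    replace (u - v)%C with (u + - (1) * v)%C by ring end.
  eapply reg_ext; [|apply reg_plus; [apply (reg_le q 0 N); [lia|exact Hs]|
    apply reg_scal, (reg_tay q a b eps m N (fun i => F i 0)); auto]].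
  intros n. unfold smp. rewrite P0. simpl pow. ring.
Qed.

(** * Schwartz functions and the distributions R_beta *)

Lemma smooth_derC phi k t : smooth phi -> derC (CDerive_n phi k) t (CDerive_n phi (S k) t).
Proof.
intros H. destruct (H (S k) t) as [H1 H2]. split; apply Derive_correct; assumption.
Qed.

Lemma CDerive_n_0 phi : CDerive_n phi 0 = phi.
Proof.
apply functional_extensionality. intros t. unfold CDerive_n. simpl.
symmetry. apply surjective_pairing.
Qed.

(** A chain of derivatives determines [CDerive_n]; this is how smoothness of newly built functions
    is established. *)
Lemma CDerive_n_family (F : nat -> R -> C) : (forall k t, derC (F k) t (F (S k) t)) ->
  (forall k, CDerive_n (F 0%nat) k = F k) /\ smooth (F 0%nat).
Proof.
intros HF.
assert (HD : forall k t, Derive_n (fun s => Re (F 0%nat s)) k t = Re (F k t) /\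
  Derive_n (fun s => Im (F 0%nat s)) k t = Im (F k t)).
{ induction k as [|k IH]; intros t; [split; reflexivity|]. simpl. split.
  - rewrite (Derive_ext _ (fun s => Re (F k s))) by (intros s; apply IH).
    apply is_derive_unique. exact (proj1 (HF k t)).
  - rewrite (Derive_ext _ (fun s => Im (F k s))) by (intros s; apply IH).
    apply is_derive_unique. exact (proj2 (HF k t)). }
split.
- intros k. apply functional_extensionality. intros t. unfold CDerive_n.
  destruct (HD k t) as [-> ->]. symmetry. apply surjective_pairing.
- intros [|k] t; [split; exact I|]. split.
  + apply (ex_derive_ext (fun s => Re (F k s))); [intros s; symmetry; apply HD|].
    exists (Re (F (S k) t)). exact (proj1 (HF k t)).
  + apply (ex_derive_ext (fun s => Im (F k s))); [intros s; symmetry; apply HD|].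
    exists (Im (F (S k) t)). exact (proj2 (HF k t)).
Qed.

Lemma schwartz_family (F : nat -> R -> C) : (forall k t, derC (F k) t (F (S k) t)) ->
  (forall k, rapid (F k)) -> schwartz (F 0%nat).
Proof.
intros HF HR. destruct (CDerive_n_family F HF) as [E Hs]. split; auto.
intros j k. rewrite E. apply HR.
Qed.

Lemma schwartz_rapid phi k : schwartz phi -> rapid (CDerive_n phi k).
Proof. intros [_ H] j. apply H. Qed.

Lemma schwartz_Sch N : forall phi k, schwartz phi -> Sch N (CDerive_n phi k).
Proof.
induction N as [|N IH]; intros phi k H; (split; [apply schwartz_rapid, H|split;
  [apply (contC_derC _ (CDerive_n phi (S k))); intros t; apply smooth_derC, H|]]).
- exact I.
- exists (CDerive_n phi (S k)). split; [intros t; apply smooth_derC, H|apply IH, H].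
Qed.

Lemma schwartz_Sch_0 N phi : schwartz phi -> Sch N phi.
Proof. intros H. rewrite <- (CDerive_n_0 phi). apply schwartz_Sch, H. Qed.

Lemma schwartz_CDerive_n phi m : schwartz phi -> schwartz (CDerive_n phi m).
Proof.
intros H. rewrite <- (Nat.add_0_r m).
apply (schwartz_family (fun k => CDerive_n phi (m + k))).
- intros k t. rewrite Nat.add_succ_r. apply smooth_derC, H.
- intros k. apply schwartz_rapid, H.
Qed.

Lemma schwartz_linear phi psi a b : schwartz phi -> schwartz psi ->
  schwartz (fun t => a * phi t + b * psi t)%C.
Proof.
intros Hf Hg. rewrite <- (CDerive_n_0 phi), <- (CDerive_n_0 psi).
apply (schwartz_family (fun k t => a * CDerive_n phi k t + b * CDerive_n psi k t)%C).
- intros k t. apply derC_plus; apply derC_scal, smooth_derC; [apply Hf|apply Hg].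
- intros k. apply rapid_plus; apply rapid_scal, schwartz_rapid; assumption.
Qed.

(** With t = x0 + eps s, |t|^j is at most 2^j (|x0|^j + (eps |s|)^j), so the decay of orders 0 and j
    suffices. *)
Lemma rapid_affine f x0 eps : 0 < eps -> rapid f -> rapid (fun t => f ((t - x0) / eps)).
Proof.
intros He Hf j. destruct (Hf 0%nat) as [A HA]. destruct (Hf j) as [B HB].
exists (2 ^ j * (Rabs x0 ^ j * A + eps ^ j * B)). intros t.
set (s := (t - x0) / eps). specialize (HA s). specialize (HB s).
assert (ht : t = x0 + eps * s) by (unfold s; field; lra).
assert (h1 : Rabs t ^ j <= 2 ^ j * (Rabs x0 ^ j + (eps * Rabs s) ^ j)).
{ assert (h2 : Rabs t <= Rabs x0 + eps * Rabs s).
  { rewrite ht at 1. eapply Rle_trans; [apply Rabs_triang|].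
    rewrite Rabs_mult, (Rabs_pos_eq eps) by lra. lra. }
  assert (h3 := Rabs_pos x0). assert (h4 := Rabs_pos s).
  assert (h5 : 0 <= eps * Rabs s) by nra.
  assert (h6 : 0 <= Rabs x0 ^ j) by (apply pow_le; auto).
  assert (h7 : 0 <= (eps * Rabs s) ^ j) by (apply pow_le; auto).
  assert (h8 : 0 <= 2 ^ j) by (apply pow_le; lra).
  destruct (Rle_dec (Rabs x0) (eps * Rabs s)) as [Hle|Hgt].
  - apply Rle_trans with ((2 * (eps * Rabs s)) ^ j).
    + apply pow_incr. split; [apply Rabs_pos|lra].
    + rewrite Rpow_mult_distr. nra.
  - apply Rle_trans with ((2 * Rabs x0) ^ j).
    + apply pow_incr. split; [apply Rabs_pos|lra].
    + rewrite Rpow_mult_distr. nra. }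
assert (h8 : 0 <= 2 ^ j) by (apply pow_le; lra).
assert (h9 := Cmod_ge_0 (f s)).
eapply Rle_trans; [apply Rmult_le_compat_r; [exact h9|exact h1]|].
rewrite Rmult_assoc. apply Rmult_le_compat_l; auto.
rewrite Rmult_plus_distr_r. apply Rplus_le_compat.
- rewrite pow_O, Rmult_1_l in HA.
  apply Rmult_le_compat_l; auto. apply pow_le, Rabs_pos.
- rewrite Rpow_mult_distr, Rmult_assoc. apply Rmult_le_compat_l; auto. apply pow_le. lra.
Qed.

Lemma schwartz_dilated phi x0 eps : 0 < eps -> schwartz phi ->
  schwartz (fun t => RtoC (/ eps) * phi ((t - x0) / eps)%R)%C.
Proof.
intros He H.
assert (h := schwartz_family
  (fun k t => RtoC ((/ eps) ^ S k) * CDerive_n phi k ((t - x0) / eps)%R)%C).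
cbv beta in h. rewrite CDerive_n_0, pow_1 in h. apply h.
- intros k t. eapply derC_eq; [|apply derC_scal,
    (derC_comp (CDerive_n phi k) (fun t => (t - x0) / eps) t
      (CDerive_n phi (S k) ((t - x0) / eps)) (/ eps));
    [apply smooth_derC, H|auto_derive; [lra|field; lra]]].
  rewrite Cmult_assoc, <- RtoC_mult. do 2 f_equal. simpl. ring.
- intros k. apply rapid_scal, (rapid_affine (CDerive_n phi k)); auto.
  apply schwartz_rapid, H.
Qed.

Lemma contC_bounded f a b : contC f -> exists B, forall t, a <= t <= b -> Cmod (f t) <= B.
Proof.
intros Hf. destruct (Rle_dec a b) as [Hab|Hab]; [|exists 0; intros; lra].
assert (P : forall u : R -> R, (forall t : R, continuous u t) ->
  exists B, forall t, a <= t <= b -> Rabs (u t) <= B).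
{ intros u Hu. destruct (continuity_ab_maj (fun t => Rabs (u t)) a b Hab) as [M [HM _]].
  - intros c _. apply (continuity_pt_comp u Rabs).
    + apply continuity_pt_filterlim, Hu.
    + apply Rcontinuity_abs.
  - exists (Rabs (u M)). exact HM. }
destruct (P (fun t => Re (f t)) (fun t => proj1 (Hf t))) as [A HA].
destruct (P (fun t => Im (f t)) (fun t => proj2 (Hf t))) as [B HB].
exists (A + B). intros t Ht. eapply Rle_trans; [apply Cmod_le_Re_Im|].
apply Rplus_le_compat; auto.
Qed.

Lemma derC_unique f x l m : derC f x l -> derC f x m -> l = m.
Proof.
intros [H1 H2] [H3 H4]. apply is_derive_unique in H1, H2, H3, H4.
apply injective_projections; unfold Re, Im in *; congruence.
Qed.

Lemma test_function_schwartz phi : test_function phi -> schwartz phi.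
Proof.
intros [Hs [A HA]]. split; auto.
assert (Hz : forall k t, A < Rabs t -> CDerive_n phi k t = 0%C).
{ induction k as [|k IH]; intros t Ht; [rewrite CDerive_n_0; auto|].
  apply (derC_unique (CDerive_n phi k) t); [apply smooth_derC, Hs|].
  apply (derC_ext_loc (fun _ => RtoC 0)); [|apply derC_const].
  assert (Hball : forall y, Rabs (y - t) < Rabs t - A -> A < Rabs y).
  { intros y Hy. assert (h := Rabs_triang_inv t y). rewrite Rabs_minus_sym in Hy. lra. }
  exists (mkposreal (Rabs t - A) ltac:(lra)). intros y Hy. symmetry. apply IH, Hball, Hy. }
intros j k.
assert (Hc : contC (CDerive_n phi k)).
{ apply (contC_derC _ (CDerive_n phi (S k))). intros t. apply smooth_derC, Hs. }
(* [A] may be negative, hence the interval with endpoints -|A| and |A|. *)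
destruct (contC_bounded _ (- Rabs A) (Rabs A) Hc) as [B HB].
exists (Rabs A ^ j * B). intros t.
assert (hA : 0 <= Rabs A ^ j) by (apply pow_le, Rabs_pos).
assert (hB : 0 <= B).
{ eapply Rle_trans; [apply Cmod_ge_0|apply (HB 0)]. assert (h := Rabs_pos A). lra. }
destruct (Rlt_dec A (Rabs t)) as [Ht|Ht].
- rewrite Hz by exact Ht. rewrite Cmod_0, Rmult_0_r. apply Rmult_le_pos; auto.
- assert (h := Rle_abs A). assert (h1 := Rle_abs t). assert (h2 := Rle_abs (- t)).
  rewrite Rabs_Ropp in h2.
  apply Rmult_le_compat; [apply pow_le, Rabs_pos|apply Cmod_ge_0| |apply HB; lra].
  apply pow_incr. split; [apply Rabs_pos|lra].
Qed.

(** [real] sends an infinite supremum to 0, so the Schwartz bound must first exclude that case. *)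
Lemma seminorm_ub phi j k t : schwartz phi ->
  Rabs t ^ j * Cmod (CDerive_n phi k t) <= schwartz_seminorm j k phi.
Proof.
intros [_ H]. destruct (H j k) as [B HB]. unfold schwartz_seminorm.
set (E := fun y => exists t : R, y = Rabs t ^ j * Cmod (CDerive_n phi k t)).
destruct (Lub_Rbar_correct E) as [H1 H2].
specialize (H2 (Finite B)).
assert (HE : E (Rabs t ^ j * Cmod (CDerive_n phi k t))) by (exists t; reflexivity).
specialize (H1 _ HE).
assert (HB' : Rbar_le (Lub_Rbar E) (Finite B)).
{ apply H2. intros y [s ->]. apply HB. }
destruct (Lub_Rbar E); simpl in *; [exact H1|contradiction|contradiction].
Qed.

Lemma seminorm_nonneg phi j k : schwartz phi -> 0 <= schwartz_seminorm j k phi.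
Proof.
intros H. eapply Rle_trans; [|apply (seminorm_ub phi j k 0 H)].
apply Rmult_le_pos; [apply pow_le, Rabs_pos|apply Cmod_ge_0].
Qed.

Definition seminorm_sum (N : nat) (phi : R -> C) : R :=
  sum_n (fun j => sum_n (fun k => schwartz_seminorm j k phi) N) N.

Lemma sum_n_nonneg (u : nat -> R) N : (forall k, 0 <= u k) -> 0 <= sum_n u N.
Proof.
intros H. induction N as [|N IH]; [rewrite sum_O; auto|].
rewrite sum_Sn. apply Rplus_le_le_0_compat; auto.
Qed.

Lemma sum_n_incr (u v : nat -> R) N N' : (forall k, 0 <= v k) -> (forall k, u k <= v k) ->
  (N <= N')%nat -> sum_n u N <= sum_n v N'.
Proof.
intros Hv Huv. induction 1 as [|N' HN IH].
- induction N as [|N IH]; [rewrite !sum_O; auto|].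
  rewrite !sum_Sn. apply Rplus_le_compat; auto.
- rewrite sum_Sn. specialize (Hv (S N')). unfold plus; simpl. lra.
Qed.

Lemma sum_n_term (u : nat -> R) k N : (forall i, 0 <= u i) -> (k <= N)%nat -> u k <= sum_n u N.
Proof.
intros H. induction 1 as [|N HN IH].
- destruct k as [|k]; [rewrite sum_O; lra|]. rewrite sum_Sn.
  assert (h := sum_n_nonneg u k H). unfold plus; simpl. lra.
- rewrite sum_Sn. specialize (H (S N)). unfold plus; simpl. lra.
Qed.

Lemma seminorm_sum_incr phi N N' : schwartz phi -> (N <= N')%nat ->
  seminorm_sum N phi <= seminorm_sum N' phi.
Proof.
intros H HN. apply sum_n_incr; auto.
- intros j. apply sum_n_nonneg. intros; apply seminorm_nonneg, H.
- intros j. apply sum_n_incr; auto; intros; try apply seminorm_nonneg, H. lra.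
Qed.

Lemma seminorm_sum_nonneg phi N : schwartz phi -> 0 <= seminorm_sum N phi.
Proof.
intros H. apply sum_n_nonneg. intros j. apply sum_n_nonneg. intros; apply seminorm_nonneg, H.
Qed.

Lemma seminorm_le_sum phi j k N : schwartz phi -> (j <= N)%nat -> (k <= N)%nat ->
  schwartz_seminorm j k phi <= seminorm_sum N phi.
Proof.
intros H Hj Hk.
eapply Rle_trans; [apply (sum_n_term (fun k => schwartz_seminorm j k phi) k N); auto|].
- intros; apply seminorm_nonneg, H.
- apply (sum_n_term (fun j => sum_n (fun k => schwartz_seminorm j k phi) N) j N); auto.
  intros i. apply sum_n_nonneg. intros; apply seminorm_nonneg, H.
Qed.

(** The weight 1 + t^2 that makes integrals converge costs two more powers of t. *)
Lemma schwartz_weight_bound phi j k t N : schwartz phi -> (j + 2 <= N)%nat -> (k <= N)%nat ->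
  (1 + t ^ 2) * (Rabs t ^ j * Cmod (CDerive_n phi k t)) <= 2 * seminorm_sum N phi.
Proof.
intros H Hj Hk.
assert (h1 := seminorm_ub phi j k t H). assert (h2 := seminorm_ub phi (2 + j) k t H).
assert (h3 := seminorm_le_sum phi j k N H ltac:(lia) Hk).
assert (h4 := seminorm_le_sum phi (2 + j) k N H ltac:(lia) Hk).
rewrite pow_add, RPow_abs, (Rabs_pos_eq (t ^ 2)) in h2 by nra. lra.
Qed.

Lemma fourier_CDerive_n phi m xi : schwartz phi ->
  fourier (CDerive_n phi m) xi = ((- (Ci * RtoC (PI * xi))) ^ m * fourier phi xi)%C.
Proof.
intros H. induction m as [|m IH].
- rewrite CDerive_n_0. simpl. ring.
- rewrite (fourier_derivative (CDerive_n phi m)), IH.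
  + simpl. ring.
  + intros t. apply smooth_derC, H.
  + apply schwartz_rapid, H.
  + apply (Sch_nice 0), schwartz_Sch, H.
Qed.

(** * The series of Fourier transforms defining [R_ beta] *)

Lemma R_term_fourier beta n phi :
  R_term beta n phi = (Cpower (INR n) (- (2 * beta)) * fourier phi (INR n ^ 2))%C.
Proof.
unfold R_term, regular, fourier. f_equal. apply integral_ext. intros t. rewrite Cexp_Ci.
reflexivity.
Qed.

(** [k] integrations by parts yield a decay n^(-2k), which brings n^(-2 Re beta) down to n^(-2). The
    constant is 2 pi from the integral times 2 from the weight. *)
Lemma R_term_bound beta k N n phi : schwartz phi -> - (2 * Re beta) - 2 * INR k <= -2 ->
  (k <= N)%nat -> (2 <= N)%nat ->
  Cmod (R_term beta (S n) phi) <= 4 * PI * seminorm_sum N phi * / INR (S n) ^ 2.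
Proof.
intros H Hk HkN HN. rewrite R_term_fourier, Cmod_mult, Cmod_Cpower.
set (x := INR (S n)). assert (hx : 1 <= x) by apply INR_S_ge_1.
assert (h1 : Cmod (fourier (CDerive_n phi k) (x ^ 2)) <= 2 * PI * (2 * seminorm_sum N phi)).
{ apply fourier_bound; [apply (Sch_cont 0), schwartz_Sch, H|].
  intros t. assert (h := schwartz_weight_bound phi 0 k t N H HN HkN).
  rewrite pow_O, Rmult_1_l in h. exact h. }
rewrite fourier_CDerive_n, Cmod_mult, Cmod_pow, Cmod_opp, Cmod_mult, Cmod_Ci, Cmod_R,
  Rmult_1_l in h1 by exact H.
assert (hpi := PI_ge_1).
rewrite Rabs_pos_eq in h1 by nra.
assert (h0 := Cmod_ge_0 (fourier phi (x ^ 2))).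
assert (h2 : (x ^ 2) ^ k * Cmod (fourier phi (x ^ 2)) <= 4 * PI * seminorm_sum N phi).
{ eapply Rle_trans; [|replace (4 * PI * seminorm_sum N phi) with
    (2 * PI * (2 * seminorm_sum N phi)) by ring; exact h1].
  apply Rmult_le_compat_r; auto. apply pow_incr. split; nra. }
assert (h3 : Rpower x (Re (- (2 * beta))%C) <= (x ^ 2) ^ k * / x ^ 2).
{ rewrite <- pow_mult, <- (Rpower_pow (2 * k)), <- Rpower_neg2, <- Rpower_plus by lra.
  apply Rle_Rpower; auto. rewrite mult_INR.
  replace (Re (- (2 * beta))%C) with (- (2 * Re beta)) by (simpl; unfold Re; simpl; ring).
  change (INR 2) with 2. lra. }
assert (h4 : 0 < / x ^ 2) by (apply Rinv_0_lt_compat; nra).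
apply Rle_trans with ((x ^ 2) ^ k * / x ^ 2 * Cmod (fourier phi (x ^ 2))).
- apply Rmult_le_compat_r; auto.
- replace ((x ^ 2) ^ k * / x ^ 2 * Cmod (fourier phi (x ^ 2))) with
    ((x ^ 2) ^ k * Cmod (fourier phi (x ^ 2)) * / x ^ 2) by ring.
  apply Rmult_le_compat_r; [lra|exact h2].
Qed.

Lemma csum_Series b s : csum b s ->
  (Series (fun n => Re (b n)), Series (fun n => Im (b n))) = s.
Proof.
intros H. rewrite csum_psum_eps in H.
assert (Ps : forall n, sum_n (fun n => Re (b n)) n = Re (psum b (S n)) /\
  sum_n (fun n => Im (b n)) n = Im (psum b (S n))).
{ induction n as [|n [I1 I2]].
  - rewrite !sum_O. simpl. unfold Re, Im. split; ring.
  - rewrite !sum_Sn, I1, I2. split; reflexivity. }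
assert (P : forall (u : nat -> R) l, (forall eps, 0 < eps -> exists N, forall n, (N <= n)%nat ->
  Rabs (sum_n u n - l) < eps) -> Series u = l).
{ intros u l Hu. apply is_series_unique.
  change (is_lim_seq (sum_n u) l). apply is_lim_seq_spec. intros eps.
  destruct (Hu eps (cond_pos eps)) as [N HN]. exists N. exact HN. }
apply injective_projections; simpl; apply P; intros eps He;
  destruct (H eps He) as [N HN]; exists N; intros n Hn;
  specialize (HN (S n) ltac:(lia)); (eapply Rle_lt_trans; [|exact HN]).
- rewrite (proj1 (Ps n)). apply (re_le_Cmod (psum b (S n) - s)).
- rewrite (proj2 (Ps n)). apply (im_le_Cmod (psum b (S n) - s)).
Qed.

(** The number of integrations by parts depends on [beta] only, so one finite sum of seminorms
    serves every test function; the telescoping majorant doubles the constant. *)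
Lemma R_csum beta : exists N K, forall phi, schwartz phi ->
  csum (fun n => R_term beta (S n) phi) (R_ beta phi) /\
  Cmod (R_ beta phi) <= K * seminorm_sum N phi.
Proof.
destruct (exists_nat_ge (1 - Re beta)) as [k Hk].
exists (k + 2)%nat, (8 * PI). intros phi H.
destruct (csum_dominated (fun n => R_term beta (S n) phi)
  (fun n => 8 * PI * seminorm_sum (k + 2) phi * (/ INR (S n) - / INR (S (S n))))
  (8 * PI * seminorm_sum (k + 2) phi)) as [s [Hs1 Hs2]].
- intros n. eapply Rle_trans;
    [apply (R_term_bound beta k (k + 2)); [exact H|lra|lia|lia]|].
  assert (h := inv_square_le n). assert (h' := seminorm_sum_nonneg phi (k + 2) H).
  assert (hpi := PI_ge_1).
  replace (8 * PI * seminorm_sum (k + 2) phi * (/ INR (S n) - / INR (S (S n)))) with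
   (4 * PI * seminorm_sum (k + 2) phi * (2 * (/ INR (S n) - / INR (S (S n))))) by ring.
  apply Rmult_le_compat_l; auto. nra.
- assert (h := is_series_scal (K := R_AbsRing) (V := R_NormedModule)
    (8 * PI * seminorm_sum (k + 2) phi) _ _ is_series_telescope).
  change (is_series (fun n => 8 * PI * seminorm_sum (k + 2) phi *
    (/ INR (S n) - / INR (S (S n)))) (8 * PI * seminorm_sum (k + 2) phi * 1)) in h.
  rewrite Rmult_1_r in h. exact h.
- assert (E : R_ beta phi = s) by exact (csum_Series _ _ Hs1).
  rewrite E. auto.
Qed.

Lemma R_correct beta phi : schwartz phi ->
  csum (fun n => R_term beta (S n) phi) (R_ beta phi).
Proof. intros H. destruct (R_csum beta) as [N [K HR]]. apply HR, H. Qed.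

Lemma fourier_linear a b phi psi xi : schwartz phi -> schwartz psi ->
  fourier (fun t => a * phi t + b * psi t)%C xi = (a * fourier phi xi + b * fourier psi xi)%C.
Proof.
intros Hf Hg. assert (Nf := Sch_nice 0 phi (schwartz_Sch_0 0 phi Hf)).
assert (Ng := Sch_nice 0 psi (schwartz_Sch_0 0 psi Hg)).
unfold fourier.
rewrite (integral_ext _ (fun t => a * (cis (PI * xi * t) * phi t)
  + b * (cis (PI * xi * t) * psi t))%C) by (intros t; ring).
assert (Cf := nice_cis (PI * xi) phi Nf). assert (Cg := nice_cis (PI * xi) psi Ng).
rewrite (integral_plus _ _ (nice_scal a _ Cf) (nice_scal b _ Cg)), !integral_scal by assumption.
reflexivity.
Qed.

Lemma tempered_R beta : tempered (R_ beta).
Proof.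
split.
- intros phi psi a b Hf Hg.
  apply (csum_unique (fun n => R_term beta (S n) (fun t => a * phi t + b * psi t)%C)).
  + apply R_correct, schwartz_linear; auto.
  + eapply csum_ext; [|apply csum_plus; apply csum_scal, R_correct; [exact Hf|exact Hg]].
    intros n. cbv beta. rewrite !R_term_fourier, fourier_linear by auto. ring.
- destruct (R_csum beta) as [N [K HR]]. exists N, K. intros phi H. apply HR, H.
Qed.

Lemma R_dist_series beta : is_dist_series1 (R_term beta) (R_ beta).
Proof. split; [apply tempered_R|]. intros phi H. apply R_correct, H. Qed.

Lemma Cpower_pow x c m : 0 < x -> Cpower x (c + 2 * RtoC (INR m)) =
  (Cpower x c * RtoC (x ^ 2) ^ m)%C.
Proof.
intros Hx. rewrite Cpower_plus. f_equal.
replace (2 * RtoC (INR m))%C with (RtoC (INR (2 * m)))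
  by (rewrite mult_INR, RtoC_mult; reflexivity).
rewrite Cpower_RtoC, Rpower_pow, pow_mult, RtoC_pow by exact Hx. reflexivity.
Qed.

(** The derivative multiplies the n-th term by (i pi n^2)^m, which replaces beta by beta - m; the
    sign (-1)^m of the distributional derivative cancels that of the integrations by parts. *)
Lemma R_derive_n beta m phi : schwartz phi -> dist_derive_n m (R_ beta) phi =
  ((Ci * RtoC PI) ^ m * R_ (beta - RtoC (INR m)) phi)%C.
Proof.
intros H. unfold dist_derive_n.
apply (csum_unique (fun n => RtoC (-1) ^ m * R_term beta (S n) (CDerive_n phi m))%C).
- apply csum_scal, R_correct, schwartz_CDerive_n, H.
- eapply csum_ext; [|apply csum_scal, R_correct, H].
  intros n. cbv beta. rewrite !R_term_fourier, fourier_CDerive_n by exact H.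
  replace (- (2 * (beta - RtoC (INR m))))%C with (- (2 * beta) + 2 * RtoC (INR m))%C by ring.
  rewrite Cpower_pow by (assert (h := INR_S_ge_1 n); lra).
  replace (- (Ci * RtoC (PI * INR (S n) ^ 2)))%C
    with (RtoC (-1) * ((Ci * RtoC PI) * RtoC (INR (S n) ^ 2)))%C
    by (rewrite RtoC_mult; apply injective_projections; simpl; ring).
  rewrite !Cpow_mult_l.
  assert (E : (RtoC (-1) ^ m * RtoC (-1) ^ m = 1)%C).
  { rewrite <- Cpow_mult_l, <- RtoC_mult. replace (-1 * -1) with 1 by ring. apply Cpow_1_l. }
  transitivity (RtoC (-1) ^ m * RtoC (-1) ^ m * ((Ci * RtoC PI) ^ m *
    (Cpower (INR (S n)) (- (2 * beta)) * RtoC (INR (S n) ^ 2) ^ m *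
      fourier phi (INR (S n) ^ 2))))%C; [rewrite E, !Cpow_mult_l; ring|].
  rewrite !Cpow_mult_l. ring.
Qed.

Lemma integral_dilated f x0 eps : 0 < eps -> nice f ->
  integral (fun t => RtoC (/ eps) * f ((t - x0) / eps)%R)%C = integral f.
Proof.
intros He Hf. apply has_integral_integral.
- apply contC_mult; [apply contC_const|]. destruct Hf as [Hc _].
  intros t. destruct (Hc ((t - x0) / eps)) as [H1 H2].
  assert (Ha : continuous (fun t => (t - x0) / eps) t).
  { apply (ex_derive_continuous (K := R_AbsRing) (V := R_NormedModule)).
    auto_derive. lra. }
  split.
  + exact (continuous_comp (fun t => (t - x0) / eps) (fun s => Re (f s)) t Ha H1).
  + exact (continuous_comp (fun t => (t - x0) / eps) (fun s => Im (f s)) t Ha H2).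
- apply has_integral_dilate; auto. apply integral_correct, Hf.
Qed.

(** Substitution t = x0 + eps s. At x0 = r and xi = n^2 the translation phase is precisely the
    antiperiodic coefficient. *)
Lemma fourier_dilated phi x0 eps xi : 0 < eps -> nice phi ->
  fourier (fun t => RtoC (/ eps) * phi ((t - x0) / eps)%R)%C xi =
  (cis (PI * x0 * xi) * fourier phi (eps * xi))%C.
Proof.
intros He Hf. unfold fourier. rewrite <- integral_scal by (apply nice_cis, Hf).
rewrite <- (integral_dilated _ x0 eps He
  (nice_scal (cis (PI * x0 * xi)) _ (nice_cis (PI * (eps * xi)) phi Hf))).
apply integral_ext. intros t.
replace (PI * xi * t) with (PI * x0 * xi + PI * (eps * xi) * ((t - x0) / eps)) by (field; lra).
rewrite cis_plus. ring.
Qed.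

Lemma R_dilate_csum beta r eps phi : 0 < eps -> schwartz phi ->
  csum (smp (gauss r) (fun x => Cpower x (- (2 * beta)) * fourier phi (eps * x ^ 2))%C)
    (dilate (R_ beta) r eps phi).
Proof.
intros He H. eapply csum_ext; [|apply R_correct, (schwartz_dilated phi r eps He H)].
intros n. cbv beta. rewrite R_term_fourier, fourier_dilated;
  [|exact He|apply (Sch_nice 0), schwartz_Sch_0, H].
unfold smp, gauss. ring.
Qed.

(** * Taylor polynomials and point values *)

(* The coefficient sequence [c] is padded with zeros, so that polynomials of different degrees
   can be added. *)
Definition padded_polynomial (P : R -> C) : Prop :=
  exists (c : nat -> C) (d : nat), forall n, (d <= n)%nat ->
    forall t, P t = psum (fun k => c k * RtoC (t ^ k))%C n.

Lemma padded_polynomial_polynomial P : padded_polynomial P -> polynomial P.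
Proof.
intros [c [d H]]. exists d, c. intros t.
rewrite (sum_n_psum (fun k => c k * RtoC (t ^ k))%C). apply H. lia.
Qed.

Lemma padded_polynomial_const a : padded_polynomial (fun _ => a).
Proof.
exists (fun k => match k return C with O => a | S _ => 0%C end), 1%nat. intros n Hn t.
destruct n as [|n]; [lia|]. clear Hn. induction n as [|n IH].
- simpl. ring.
- cbn [psum]. cbn [psum] in IH. rewrite <- IH. ring.
Qed.

Lemma padded_polynomial_plus P Q : padded_polynomial P -> padded_polynomial Q ->
  padded_polynomial (fun t => P t + Q t)%C.
Proof.
intros [c [d H]] [c' [d' H']]. exists (fun k => c k + c' k)%C, (Nat.max d d').
intros n Hn t. rewrite (H n) by lia. rewrite (H' n) by lia. rewrite <- psum_plus.
apply psum_ext. intros k _. ring.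
Qed.

Lemma padded_polynomial_scal a P : padded_polynomial P -> padded_polynomial (fun t => a * P t)%C.
Proof.
intros [c [d H]]. exists (fun k => a * c k)%C, d.
intros n Hn t. rewrite (H n) by lia. rewrite <- psum_scal.
apply psum_ext. intros k _. ring.
Qed.

Lemma padded_polynomial_mult_t P : padded_polynomial P ->
  padded_polynomial (fun t => RtoC t * P t)%C.
Proof.
intros [c [d H]]. exists (fun k => match k return C with O => 0%C | S k => c k end), (S d).
intros n Hn t. destruct n as [|n]; [lia|]. rewrite (H n) by lia. clear.
induction n as [|n IH].
- simpl. ring.
- cbn [psum] in *. rewrite <- IH. simpl pow. rewrite RtoC_mult. ring.
Qed.

Lemma padded_polynomial_pow a r k : padded_polynomial (fun t => (a * RtoC (t - r)) ^ k)%C.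
Proof.
induction k as [|k IH].
- exact (padded_polynomial_const 1).
- replace (fun t => (a * RtoC (t - r)) ^ S k)%C with
   (fun t => a * (RtoC t * (a * RtoC (t - r)) ^ k) + - (a * RtoC r) * (a * RtoC (t - r)) ^ k)%C.
  + apply padded_polynomial_plus; apply padded_polynomial_scal; auto.
    apply padded_polynomial_mult_t, IH.
  + apply functional_extensionality. intros t. rewrite RtoC_minus. simpl. ring.
Qed.

Lemma padded_polynomial_psum (Q : nat -> R -> C) n : (forall k, padded_polynomial (Q k)) ->
  padded_polynomial (fun t => psum (fun k => Q k t) n).
Proof.
intros H. induction n as [|n IH].
- exact (padded_polynomial_const 0).
- exact (padded_polynomial_plus _ _ IH (H n)).
Qed.

Lemma polynomial_bound P : polynomial P -> contC P /\ exists N K, 0 <= K /\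
  forall phi, schwartz phi -> forall t,
    (1 + t ^ 2) * Cmod (P t * phi t)%C <= K * seminorm_sum N phi.
Proof.
intros [d [c H]].
assert (E : P = fun t => psum (fun k => c k * RtoC (t ^ k))%C (S d)).
{ apply functional_extensionality. intros t. rewrite H. apply sum_n_psum. }
rewrite E. clear E H P. split.
- generalize (S d). induction n as [|n IH]; [exact (contC_const 0)|].
  apply (contC_plus _ _ IH), (contC_mult (fun _ => c n)); [apply contC_const|].
  apply (contC_derC _ (fun t => RtoC (INR n * 1 * t ^ Init.Nat.pred n))). intros t.
  apply derC_RtoC, (is_derive_pow (fun y => y)), @is_derive_id.
- exists (d + 2)%nat. assert (Ind : forall n, (n <= S d)%nat -> exists K, 0 <= K /\
    forall phi, schwartz phi -> forall t,
    (1 + t ^ 2) * Cmod (psum (fun k => c k * RtoC (t ^ k)) n * phi t)%C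
      <= K * seminorm_sum (d + 2) phi).
  2: { apply (Ind (S d)). lia. }
  induction n as [|n IH]; intros Hn.
  + exists 0. split; [lra|]. intros phi _ t. simpl.
    rewrite Cmult_0_l, Cmod_0. lra.
  + destruct IH as [K [HK HI]]; [lia|]. assert (hc := Cmod_ge_0 (c n)).
    exists (K + Cmod (c n) * 2). split; [lra|]. intros phi Hp t.
    specialize (HI phi Hp t).
    assert (h := schwartz_weight_bound phi n 0 t (d + 2) Hp ltac:(lia) ltac:(lia)).
    rewrite CDerive_n_0 in h. cbn [psum].
    set (u := psum _ n) in *.
    replace ((u + c n * RtoC (t ^ n)) * phi t)%C
      with (u * phi t + c n * (RtoC (t ^ n) * phi t))%C by ring.
    assert (h1 := Cmod_triangle (u * phi t) (c n * (RtoC (t ^ n) * phi t))).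
    rewrite (Cmod_mult (c n)), (Cmod_mult (RtoC (t ^ n))), Cmod_R, <- RPow_abs in h1.
    assert (h2 : 0 <= 1 + t ^ 2) by nra.
    eapply Rle_trans; [apply Rmult_le_compat_l; [exact h2|exact h1]|].
    assert (h3 := Rmult_le_compat_l _ _ _ hc h). lra.
Qed.

Lemma polynomial_nice P phi : polynomial P -> schwartz phi -> nice (fun t => P t * phi t)%C.
Proof.
intros HP Hf. destruct (polynomial_bound P HP) as [Hc [N [K [_ HB]]]]. split.
- apply contC_mult; auto. apply (Sch_cont 0), schwartz_Sch_0, Hf.
- eexists. apply HB, Hf.
Qed.

Lemma tempered_regular P : polynomial P -> tempered (regular P).
Proof.
intros HP. split.
- intros phi psi a b Hf Hg. unfold regular.
  assert (Nf := polynomial_nice P phi HP Hf). assert (Ng := polynomial_nice P psi HP Hg).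
  rewrite <- !integral_scal by assumption.
  rewrite <- (integral_plus _ _ (nice_scal a _ Nf) (nice_scal b _ Ng)).
  apply integral_ext. intros t. ring.
- destruct (polynomial_bound P HP) as [Hc [N [K [HK HB]]]].
  exists N, (2 * PI * K). intros phi Hf.
  replace (2 * PI * K * _) with (2 * PI * (K * seminorm_sum N phi))
    by (unfold seminorm_sum; ring).
  apply integral_bound; [|apply HB, Hf]. apply (polynomial_nice P phi HP Hf).
Qed.

Lemma tempered_minus u v : tempered u -> tempered v -> tempered (dist_minus u v).
Proof.
intros [Lu [N [K HK]]] [Lv [N' [K' HK']]]. split.
- intros phi psi a b Hf Hg. unfold dist_minus. rewrite Lu, Lv by assumption. ring.
- exists (Nat.max N N'), (Rabs K + Rabs K'). intros phi Hf. unfold dist_minus, Cminus.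
  eapply Rle_trans; [apply Cmod_triangle|]. rewrite Cmod_opp, Rmult_plus_distr_r.
  assert (P : forall L M (w : R), (M <= Nat.max N N')%nat -> w <= L * seminorm_sum M phi ->
    w <= Rabs L * seminorm_sum (Nat.max N N') phi).
  { intros L M w HM Hw. eapply Rle_trans; [exact Hw|].
    assert (h1 := seminorm_sum_incr phi M _ Hf HM).
    assert (h2 := seminorm_sum_nonneg phi M Hf).
    apply Rle_trans with (Rabs L * seminorm_sum M phi).
    - apply Rmult_le_compat_r; auto. apply Rle_abs.
    - apply Rmult_le_compat_l; auto. apply Rabs_pos. }
  apply Rplus_le_compat.
  + apply (P K N); [lia|apply HK, Hf].
  + apply (P K' N'); [lia|apply HK', Hf].
Qed.

Lemma mult_ipit_n_pow k f t : mult_ipit_n k f t = ((Ci * RtoC PI * RtoC t) ^ k * f t)%C.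
Proof. induction k as [|k IH]; simpl; [ring|]. unfold mult_ipit. rewrite IH. ring. Qed.

Lemma fourier_0 f : fourier f 0 = integral f.
Proof.
apply integral_ext. intros t. replace (PI * 0 * t) with 0 by ring.
unfold cis. rewrite cos_0, sin_0. apply (Cmult_1_l (f t)).
Qed.

(** The formal Taylor polynomial at [r], with (i pi)^i zeta_r(2 beta - 2i) as i-th derivative. *)
Definition taylor_poly (zeta_r : C -> C) (beta : C) (r : R) (m : nat) (t : R) : C :=
  psum (fun i => RtoC (/ INR (fact i)) * zeta_r (2 * beta - 2 * RtoC (INR i)) *
    (Ci * RtoC PI * RtoC (t - r)) ^ i)%C m.

Lemma taylor_poly_polynomial zeta_r beta r m : polynomial (taylor_poly zeta_r beta r m).
Proof.
apply padded_polynomial_polynomial, padded_polynomial_psum. intros k.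
apply padded_polynomial_scal, padded_polynomial_pow.
Qed.

(** After t = r + eps s the moments of (i pi s)^i against phi appear, and these are the derivatives
    at 0 of its transform. The dilated polynomial thus reproduces the main part of the expansion
    exactly. *)
Lemma regular_taylor_poly_dilate zeta_r beta r m phi eps : 0 < eps -> schwartz phi ->
  dilate (regular (taylor_poly zeta_r beta r m)) r eps phi =
  psum (fun i => fourier (mult_ipit_n i phi) 0 * RtoC (eps ^ i / INR (fact i)) *
    zeta_r (2 * beta - 2 * RtoC (INR i)))%C m.
Proof.
intros He Hf. unfold dilate, regular.
assert (Nk : forall k, nice (mult_ipit_n k phi)).
{ intros k. apply (Sch_nice 0), Sch_mult_ipit_n, schwartz_Sch_0, Hf. }
set (c := fun i => (RtoC (eps ^ i / INR (fact i)) * zeta_r (2 * beta - 2 * RtoC (INR i)))%C).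
assert (Ind : forall n, nice (fun s => psum (fun i => c i * mult_ipit_n i phi s)%C n) /\
  integral (fun s => psum (fun i => c i * mult_ipit_n i phi s)%C n) =
  psum (fun i => c i * integral (mult_ipit_n i phi))%C n).
{ induction n as [|n [I1 I2]].
  - assert (N0 : nice (fun _ => RtoC 0)).
    { split; [apply contC_const|]. exists 0. intros t. rewrite Cmod_0. lra. }
    split; [exact N0|].
    change (integral (fun _ => RtoC 0) = 0%C).
    transitivity (RtoC 0 * integral (fun _ => RtoC 0))%C; [|ring].
    rewrite <- integral_scal by exact N0. apply integral_ext. intros t. ring.
  - assert (Nn := nice_scal (c n) _ (Nk n)). cbn [psum]. split.
    + apply (nice_plus _ _ I1 Nn).
    + rewrite (integral_plus _ _ I1 Nn), I2, integral_scal by apply Nk. reflexivity. }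
destruct (Ind m) as [I1 I2].
transitivity (integral (fun s => psum (fun i => c i * mult_ipit_n i phi s)%C m)).
- rewrite <- (integral_dilated _ r eps He I1). apply integral_ext. intros t.
  unfold taylor_poly. set (s := (t - r) / eps).
  replace (t - r) with (eps * s) by (unfold s; field; lra).
  transitivity (RtoC (/ eps) * (phi s * psum (fun i => RtoC (/ INR (fact i)) *
    zeta_r (2 * beta - 2 * RtoC (INR i)) * (Ci * RtoC PI * RtoC (eps * s)) ^ i) m))%C; [ring|].
  f_equal. rewrite <- psum_scal. apply psum_ext. intros i _.
  rewrite mult_ipit_n_pow. unfold c, Rdiv. rewrite !RtoC_mult, RtoC_pow.
  replace (Ci * RtoC PI * (RtoC eps * RtoC s))%C
    with (RtoC eps * (Ci * RtoC PI * RtoC s))%C by ring.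
  rewrite (Cpow_mult_l (RtoC eps)). ring.
- rewrite I2. apply psum_ext. intros i _. rewrite fourier_0. unfold c. ring.
Qed.

Lemma R_expansion q r beta m phi : antiperiodic q (gauss r) -> schwartz phi ->
  exists K, forall eps, 0 < eps ->
  Cmod (dilate (R_ beta) r eps phi -
    psum (fun i => fourier (mult_ipit_n i phi) 0 * RtoC (eps ^ i / INR (fact i)) *
      zeta q (gauss r) (2 * beta - 2 * RtoC (INR i))) m)%C <= K * eps ^ m.
Proof.
intros Ha Hf.
destruct (expansion q (gauss r) (2 * beta) m (fun k => fourier (mult_ipit_n k phi)) Ha)
  as [K HK].
{ apply fourier_family. intros N. apply schwartz_Sch_0, Hf. }
exists K. intros eps He. apply HK; auto. apply (R_dilate_csum beta r eps phi He Hf).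
Qed.

Lemma pow_le_Rpower eps alpha m : 0 < eps < 1 -> alpha <= INR m -> eps ^ m <= Rpower eps alpha.
Proof.
intros He Hm. rewrite <- Rpower_pow by lra. unfold Rpower.
assert (h : ln eps < 0) by (rewrite <- ln_1; apply ln_increasing; lra).
destruct (Req_dec alpha (INR m)) as [->|Hne]; [lra|].
apply Rlt_le, exp_increasing. nra.
Qed.

Lemma R_Cw_infty q r beta : antiperiodic q (gauss r) -> Cw_infty r (R_ beta).
Proof.
intros Ha alpha. split; [apply tempered_R|].
destruct (exists_nat_ge alpha) as [m Hm].
assert (HP := taylor_poly_polynomial (zeta q (gauss r)) beta r m).
exists (taylor_poly (zeta q (gauss r)) beta r m). split; [exact HP|]. split.
- apply tempered_minus; [apply tempered_R|apply tempered_regular, HP].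
- intros phi Hf. destruct (R_expansion q r beta m phi Ha Hf) as [K HK].
  (* For eps < 1 the bound eps^m is at most eps^alpha, since m >= alpha. *)
  exists (Rabs K). exists (mkposreal 1 Rlt_0_1). intros eps Hb He.
  change (Rabs (eps - 0) < 1) in Hb. rewrite Rminus_0_r, Rabs_pos_eq in Hb by lra.
  change (dilate (dist_minus (R_ beta) (regular (taylor_poly (zeta q (gauss r)) beta r m)))
    r eps phi) with (dilate (R_ beta) r eps phi -
      dilate (regular (taylor_poly (zeta q (gauss r)) beta r m)) r eps phi)%C.
  rewrite regular_taylor_poly_dilate by assumption.
  eapply Rle_trans; [apply HK, He|].
  apply Rle_trans with (Rabs K * eps ^ m).
  + apply Rmult_le_compat_r; [apply pow_le; lra|apply Rle_abs].
  + apply Rmult_le_compat_l; [apply Rabs_pos|]. apply pow_le_Rpower; auto.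
Qed.

(** The expansion with one term has error O(eps), and its term is the integral of phi times zeta(2
    beta). *)
Lemma R_point_value q r beta : antiperiodic q (gauss r) ->
  point_value (R_ beta) r (zeta q (gauss r) (2 * beta)).
Proof.
intros Ha phi Ht. assert (Hf := test_function_schwartz phi Ht).
destruct (R_expansion q r beta 1 phi Ha Hf) as [K HK].
apply (filterlim_C (at_right 0)). intros eps He.
assert (hK := Rabs_pos K).
exists (mkposreal (eps / (Rabs K + 1)) ltac:(apply Rdiv_lt_0_compat; lra)).
intros x Hb Hx. change (Rabs (x - 0) < eps / (Rabs K + 1)) in Hb.
rewrite Rminus_0_r, Rabs_pos_eq in Hb by lra.
specialize (HK x Hx). simpl psum in HK. rewrite fourier_0, pow_1 in HK.
replace (1 / 1) with 1 in HK by field.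
replace (2 * beta - 2 * 0)%C with (2 * beta)%C in HK by ring.
replace (dilate (R_ beta) r x phi - zeta q (gauss r) (2 * beta) * integral phi)%C with
  (dilate (R_ beta) r x phi - (0 + integral phi * 1 * zeta q (gauss r) (2 * beta)))%C by ring.
eapply Rle_lt_trans; [exact HK|]. assert (h := Rle_abs K).
apply Rle_lt_trans with (Rabs K * (eps / (Rabs K + 1))).
- apply Rle_trans with (Rabs K * x); [apply Rmult_le_compat_r|apply Rmult_le_compat_l]; lra.
- apply Rmult_lt_reg_r with (Rabs K + 1); [lra|]. field_simplify; [nra|lra].
Qed.

Lemma R_derivative_point_value q r beta m : antiperiodic q (gauss r) ->
  point_value (dist_derive_n m (R_ beta)) r
    ((Ci * RtoC PI) ^ m * zeta q (gauss r) (2 * beta - 2 * RtoC (INR m)))%C.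
Proof.
intros Ha phi Ht. assert (Hf := test_function_schwartz phi Ht).
assert (H := R_point_value q r (beta - RtoC (INR m)) Ha phi Ht).
replace (2 * (beta - RtoC (INR m)))%C with (2 * beta - 2 * RtoC (INR m))%C in H by ring.
apply (filterlim_Cscal (at_right 0) ((Ci * RtoC PI) ^ m)%C) in H.
rewrite Cmult_assoc in H.
(* The derivative formula holds on Schwartz functions, and the dilated test function is one for eps
   > 0, so the two functions of eps are compared only there. *)
apply (filterlim_within_ext (F := locally 0) (fun x => 0 < x)
  (fun eps => (Ci * RtoC PI) ^ m * dilate (R_ (beta - RtoC (INR m))) r eps phi)%C); [|exact H].
intros eps He. symmetry. apply R_derive_n, schwartz_dilated; auto.
Qed.

Theorem theorem8p18 :
  (forall w : Rhat,
     S1 w <-> exists nu j : Z, w = Some (IZR (2 * nu + 1) / IZR (2 * j + 1))) /\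
  (forall beta : C, is_dist_series1 (R_term beta) (R_ beta)) /\
  forall r : R, S1 (Some r) ->
    (forall beta : C, Cw_infty r (R_ beta)) /\
    exists zeta_r : C -> C,
      (forall z : C, cesaro_sum (zeta_term r z) (zeta_r z)) /\
      entire zeta_r /\
      (forall z : C, 1 <= Re z -> is_series1 (zeta_term r z) (zeta_r z)) /\
      (forall (beta : C) (m : nat),
         point_value (dist_derive_n m (R_ beta)) r
           ((Ci * RtoC PI) ^ m * zeta_r (2 * beta - 2 * RtoC (INR m)))%C).
Proof.
split; [exact S1_iff_odd_ratio|]. split; [exact R_dist_series|].
intros r Hr. apply S1_iff_odd_ratio in Hr. destruct Hr as [nu [j E]].
injection E as ->.
assert (Ha := gauss_antiperiodic nu j).
set (q := Z.abs_nat (2 * j + 1)) in *.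
set (r := IZR (2 * nu + 1) / IZR (2 * j + 1)) in *.
split; [intros beta; apply (R_Cw_infty q), Ha|].
exists (zeta q (gauss r)). split; [|split; [|split]].
- intros z. apply zeta_cesaro; auto. intros n. apply zeta_term_dirichlet.
- apply zeta_entire, Ha.
- intros z Hz. eapply csum_ext; [|apply (zeta_convergent q (gauss r) z Ha Hz)].
  intros n. symmetry. apply zeta_term_dirichlet.
- intros beta m. apply R_derivative_point_value, Ha.
Qed.
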